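(* Let $0<M<\infty$ and let $f\in H^2(\mathbb{D},M)$. Let $\tilde f_1=f$ and, for $k=1,2,\dots$, let $a_k\in\mathbb{D}$ satisfy $$|\langle \tilde f_k,e_{a_k}\rangle|=\max\{|\langle \tilde f_k,e_a\rangle| : a\in\mathbb{D}\},\qquad \tilde f_{k+1}(z)=\frac{\tilde f_k(z)-\langle \tilde f_k,e_{a_k}\rangle e_{a_k}(z)}{\left(\frac{z-a_k}{1-\overline{a}_kz}\right)^2},$$ and let $\{\tilde B_k\}_{k=1}^\infty$ be the double Takenaka–Malmquist system generated by $a_1,a_2,\dots$. Then for every $n\ge1$ the $n$-th standard orthogonal remainder $$\tilde g_n=f-\sum_{j=1}^{n-1}\langle f,\tilde B_j\rangle\tilde B_j\qquad(\tilde g_1=f)$$ satisfies $$\|\tilde g_n\|\le\frac{M}{\sqrt n}.$$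
   Context: $\mathbb{D}$ is the open unit disc and $H^2(\mathbb{D})$ is the Hardy space of functions $f(z)=\sum_{k\ge0}c_kz^k$ with $\|f\|^2=\sum_{k\ge 0}|c_k|^2<\infty$, with inner product $\langle f,g\rangle=\frac1{2\pi}\int_0^{2\pi}f(e^{it})\overline{g(e^{it})}\,dt$ of the boundary values. For $a\in\mathbb{D}$, $e_a(z)=\frac{\sqrt{1-|a|^2}}{1-\overline{a}z}$ is the normalized Szegő kernel, so that $\langle f,e_a\rangle=\sqrt{1-|a|^2}\,f(a)$. For $0<M<\infty$, $H^2(\mathbb{D},M)$ is the set of $f\in H^2(\mathbb{D})$ for which there exist a sequence $\{b_k\}\subset\mathbb{D}$ and complex numbers $c_k$ with $\sum_{k=1}^\infty|c_k|\le M$ and $f=\sum_{k=1}^\infty c_ke_{b_k}$ in $H^2(\mathbb{D})$. The maxima above are attained in $\mathbb{D}$, and for maximizing $a_k$ each $\tilde f_{k+1}$ is (after removing the singularity at $a_k$) in $H^2(\mathbb{D})$. The double Takenaka–Malmquist system generated by $a_1,a_2,\dots$ is $\tilde B_1=e_{a_1}$ and $\tilde B_k(z)=e_{a_k}(z)\prod_{l=1}^{k-1}\left(\frac{z-a_l}{1-\overline{a}_lz}\right)^2$ for $k\ge2$; it is an orthonormal system. *)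

(* Defs.v *)
From mathcomp Require Import all_boot all_order all_algebra.
From mathcomp Require Import complex.
From mathcomp Require Import all_classical all_reals all_analysis.
Set Implicit Arguments.
Unset Strict Implicit.
Unset Printing Implicit Defensive.
Import Order.TTheory GRing.Theory Num.Theory.
Import numFieldNormedType.Exports.
Import Normc.
Local Open Scope classical_set_scope.
Local Open Scope ring_scope.
Local Open Scope complex_scope.

Section Hardy.
Context {R : realType}.
Local Notation C := R[i].

(* [R[i]] gets its norm topology through the alias [R[i]^o].
   Functions on the disc are total functions [C -> C]; only their values on
   [disc] matter in all the notions below. *)
Implicit Types f g : C -> C.

Definition disc : set C := [set z | `|z| < 1].

Definition expi (t : R) : C := cos t +i* sin t.

Definition has_taylor f (c : nat -> C) : Prop :=
  forall z, disc z ->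
    (series (fun k => c k * z ^+ k) : nat -> C^o) @ \oo --> (f z : C^o).

(* Such a sequence is unique when it exists. *)
Definition taylor f : nat -> C := xget (fun=> 0) [set c | has_taylor f c].

Definition normsq f : \bar R :=
  (\sum_(0 <= k <oo) (normc (taylor f k) ^+ 2)%:E)%E.

Definition H2 f : Prop :=
  has_taylor f (taylor f) /\ (normsq f < +oo)%E.

Definition h2norm f : R := Num.sqrt (fine (normsq f)).

Definition circle_par : set R := `[0, 2 * pi]%classic.

(* [F t] is the boundary value at [expi t]: [F] is the limit in L^2 of the
   circle of the dilates [f (r e^(it))] as [r] tends to 1 from below. *)
Definition has_boundary f (F : R -> C) : Prop :=
  [/\ measurable_fun circle_par (fun t => complex.Re (F t)),
      measurable_fun circle_par (fun t => complex.Im (F t)),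
      (\int[lebesgue_measure]_(t in circle_par) (normc (F t) ^+ 2)%:E < +oo)%E
    & (\int[lebesgue_measure]_(t in circle_par)
          (normc (f (r%:C * expi t) - F t) ^+ 2)%:E)%E @[r --> 1^'-] --> 0%E].

(* Every function in [H2] has a boundary function, unique almost everywhere,
   so the inner product below does not depend on the choice. *)
Definition boundary f : R -> C := xget (fun=> 0) [set F | has_boundary f F].

Definition circle_int (F : R -> C) : C :=
  (\int[lebesgue_measure]_(t in circle_par) complex.Re (F t)) +i*
  (\int[lebesgue_measure]_(t in circle_par) complex.Im (F t)).

Definition ip f g : C :=
  ((2 * pi)^-1)%:C *
    circle_int (fun t => boundary f t * (boundary g t)^*).

Definition szego (a : C) : C -> C := fun z =>
  (Num.sqrt (1 - normc a ^+ 2))%:C / (1 - a^* * z).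

Definition moebius (a : C) : C -> C := fun z => (z - a) / (1 - a^* * z).

(* The sequences [b] and [c] are indexed from 0. *)
Definition H2_atomic (M : R) f : Prop :=
  H2 f /\
  exists b c : nat -> C,
    [/\ forall k, disc (b k),
        (\sum_(0 <= k <oo) (normc (c k))%:E <= M%:E)%E
      & h2norm (fun z => f z - \sum_(k < n) c k * szego (b k) z)
          @[n --> \oo] --> 0].

Definition maximizes f (a : C) : Prop :=
  disc a /\
  forall b, disc b -> `|ip f (szego b)| <= `|ip f (szego a)|.

(* The quotient is not defined at [a]; continuity of [g] there says that its
   value at [a] is the one that removes the singularity. *)
Definition deflation f (a : C) g : Prop :=
  (forall z, disc z -> z != a ->
     g z = (f z - ip f (szego a) * szego a z) / moebius a z ^+ 2) /\
  {for (a : C^o), continuous (g : C^o -> C^o)}.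

(* The parameters [a] are indexed from 1; [a 0] is not used for [1 <= k]. *)
Definition double_TM (a : nat -> C) (k : nat) : C -> C := fun z =>
  szego (a k) z * \prod_(1 <= l < k) moebius (a l) z ^+ 2.

Definition remainder f (a : nat -> C) (n : nat) : C -> C := fun z =>
  f z - \sum_(1 <= j < n) ip f (double_TM a j) * double_TM a j z.

End Hardy.

(* Main.v *)
Require Import Defs.
From mathcomp Require Import all_boot all_order all_algebra.
From mathcomp Require Import complex.
From mathcomp Require Import all_classical all_reals all_analysis.
From mathcomp Require Import measurable_realfun.
From mathcomp Require Import ring lra.
Set Implicit Arguments.
Unset Strict Implicit.
Unset Printing Implicit Defensive.
Import Order.TTheory GRing.Theory Num.Theory.
Import numFieldNormedType.Exports.
Import Normc.
Local Open Scope classical_set_scope.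
Local Open Scope ring_scope.
Local Open Scope complex_scope.

(** Write [r_n] for the squared norm of the iterate [ft n.+1] and [x_n] for its
pairing with the kernel at its maximizing point.  The argument is the usual one
for orthogonal greedy algorithms.

Unfolding the recursion writes [f] as the sum of the [x_j] times the members of
the double system, [j < n], plus [P_n ft n.+1], where [P_n] is the product of the
first [n] squared Moebius factors ([greedy_expansion]).  Multiplication by a
Moebius factor is an isometry ([dot_mmul]), and a function that vanishes at a
point is orthogonal to the kernel there, so the terms are orthogonal.  Hence the
[x_j] are the Fourier coefficients of [f] ([ip_TM]), the remainder is
[P_n ft n.+1], its squared norm is [r_n], and [r_n = |x_n|^2 + r_(n+1)]
([r_step]).

By orthogonality [r_n] is also the pairing of the remainder with [f].  Expand
[f] in its atoms: on the disc [|P_n| <= 1], so the pairing of the remainder with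
the kernel at [b] is at most the pairing of the iterate with that kernel, which
maximality bounds by [|x_n|] ([dot_kernel_le]).  Therefore [r_n <= M |x_n|]
([r_le_atomic]), so [r_(n+1) <= r_n - r_n^2 / M^2] with [r_0 <= M^2], and
[r_n <= M^2 / (n+1)] follows by induction ([greedy_rate]).

All this takes place in the space of square-summable coefficient sequences.  The
bridge to the inner product of boundary values is [ipE].  Boundary functions
exist by a Riesz-Fischer argument ([ae_limit], [boundary_exists]); every
boundary function satisfies Parseval's identity ([boundary_norm]); polarization
does the rest ([Rintegral_cross]).  Integrals are computed only for
trigonometric polynomials, and Fatou's lemma ([circle_sq_lim]) passes the bounds
to infinite series.  That the iterates stay square summable comes from
[deflationP], where continuity at the removed singularity forces a double zero. *)

(** * Limits and series of complex numbers *)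

Section ComplexLimits.
Context {R : realType}.
Local Notation C := R[i].
Implicit Types (z w : C) (u v : nat -> C).

Lemma normrE z : `|z| = (normc z)%:C. Proof. by []. Qed.

Lemma normc_ge0 z : 0 <= normc z.
Proof. by case: z => x y; exact: sqrtr_ge0. Qed.

Lemma normc2E z : normc z ^+ 2 = complex.Re z ^+ 2 + complex.Im z ^+ 2.
Proof. by case: z => x y /=; rewrite sqr_sqrtr // addr_ge0 ?sqr_ge0. Qed.

Lemma normc_subC z w : normc (z - w) = normc (w - z).
Proof. by rewrite -normcN opprB. Qed.

Lemma normc_exp z n : normc (z ^+ n) = normc z ^+ n.
Proof.
elim: n => [|n IH]; first by rewrite !expr0 normc1.
by rewrite !exprS normcM IH.
Qed.

Lemma normc_real (x : R) : normc x%:C = `|x|.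
Proof. by rewrite /= expr0n addr0 sqrtr_sqr. Qed.

Lemma normc_conj z : normc z^* = normc z.
Proof. by case: z => x y /=; rewrite sqrrN. Qed.

Lemma mulcJ z : z * z^* = (normc z ^+ 2)%:C.
Proof. by rewrite normc2E; case: z => x y /=; simpc; congr (_ +i* _); ring. Qed.

Lemma normr_Re_le z : `|complex.Re z| <= normc z.
Proof.
rewrite -(@ler_pXn2r _ 2%N) ?nnegrE ?normc_ge0 // normc2E.
by rewrite real_normK ?num_real // lerDl sqr_ge0.
Qed.

Lemma normr_Im_le z : `|complex.Im z| <= normc z.
Proof.
rewrite -(@ler_pXn2r _ 2%N) ?nnegrE ?normc_ge0 // normc2E.
by rewrite real_normK ?num_real // lerDr sqr_ge0.
Qed.

Lemma normc_le_ReIm z : normc z <= `|complex.Re z| + `|complex.Im z|.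
Proof.
rewrite -(@ler_pXn2r _ 2%N) ?nnegrE ?normc_ge0 ?addr_ge0 // normc2E sqrrD.
by rewrite !real_normK ?num_real // lerD2r lerDl mulrn_wge0 // mulr_ge0.
Qed.

Lemma ReB z w : complex.Re (z - w) = complex.Re z - complex.Re w.
Proof. by case: z w => [? ?] [? ?]. Qed.

Lemma ImB z w : complex.Im (z - w) = complex.Im z - complex.Im w.
Proof. by case: z w => [? ?] [? ?]. Qed.

Lemma ReD z w : complex.Re (z + w) = complex.Re z + complex.Re w.
Proof. by case: z w => [? ?] [? ?]. Qed.

Lemma ImD z w : complex.Im (z + w) = complex.Im z + complex.Im w.
Proof. by case: z w => [? ?] [? ?]. Qed.

Lemma ler_dist_normc z w : `|normc z - normc w| <= normc (z - w).
Proof.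
rewrite ler_norml lerBlDr lerNl opprB lerBlDr; apply/andP; split.
  by rewrite normc_subC; apply: le_trans (le_normcD _ _); rewrite subrK.
by apply: le_trans (le_normcD _ _); rewrite subrK.
Qed.

Lemma discP z : disc z <-> normc z < 1.
Proof. by rewrite /disc /= normrE -[1]/(1%:C) ltcR. Qed.

(** Radii of balls in [R[i]] are themselves complex; this reduces convergence
to a limit of real numbers. *)
Lemma cvgcP u z : (u : nat -> C^o) @ \oo --> (z : C^o) <->
  normc (u n - z) @[n --> \oo] --> 0.
Proof.
split=> [|] /cvgrPdist_lt h; apply/cvgrPdist_lt => e e0.
  have := h e%:C; rewrite -[0]/(0%:C) ltcR => /(_ e0); apply: filterS => n.
  by rewrite normrE ltcR distrC subr0 ger0_norm ?normc_ge0 // normc_subC.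
move: e0; case: e => x y; rewrite ltcE /= => /andP[/eqP -> x0].
have := h x x0; apply: filterS => n.
by rewrite normrE ltcR distrC subr0 ger0_norm ?normc_ge0 // normc_subC.
Qed.

Lemma near_normc z (r : R) : 0 < r ->
  \forall w \near (z : C^o), normc (z - w) < r.
Proof.
move=> r0; apply/(@nbhs_normP C C^o); exists r%:C => /=; first by rewrite ltcR.
by move=> w /=; rewrite normrE ltcR.
Qed.

(** Through this the completeness of the real line serves for complex series. *)
Lemma cvg_ReIm u z : (u : nat -> C^o) @ \oo --> (z : C^o) <->
  (complex.Re (u n) @[n --> \oo] --> complex.Re z) /\
  (complex.Im (u n) @[n --> \oo] --> complex.Im z).
Proof.
split=> [/cvgcP|[hr hi]]; last apply/cvgcP.
  move=> /cvgrPdist_lt h; split; apply/cvgrPdist_lt => e /h; apply: filterS => n.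
    rewrite distrC subr0 ger0_norm ?normc_ge0 //; apply: le_lt_trans.
    by rewrite distrC -ReB normr_Re_le.
  rewrite distrC subr0 ger0_norm ?normc_ge0 //; apply: le_lt_trans.
  by rewrite distrC -ImB normr_Im_le.
have h : `|complex.Re (u n) - complex.Re z| + `|complex.Im (u n) - complex.Im z|
    @[n --> \oo] --> 0 + 0.
  by apply: cvgD; apply/norm_cvg0P/subr_cvg0.
rewrite addr0 in h.
apply: (squeeze_cvgr _ (cvg_cst 0) h); apply: nearW => n.
by rewrite normc_ge0 (le_trans (normc_le_ReIm _)) // ReB ImB.
Qed.

Lemma cvgc_unique u z w : (u : nat -> C^o) @ \oo --> (z : C^o) ->
  (u : nat -> C^o) @ \oo --> (w : C^o) -> z = w.
Proof. exact: (@cvg_unique _ (@norm_hausdorff _ C^o)). Qed.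

Lemma cvgc_eq u v z : (forall n, u n = v n) ->
  (u : nat -> C^o) @ \oo --> (z : C^o) -> (v : nat -> C^o) @ \oo --> (z : C^o).
Proof. by move=> /funext ->. Qed.

Lemma cvgc_cst z : ((fun=> z) : nat -> C^o) @ \oo --> (z : C^o).
Proof. exact: cvg_cst. Qed.

Lemma cvgc_shiftS u z : ((fun n => u n.+1) : nat -> C^o) @ \oo --> (z : C^o) ->
  (u : nat -> C^o) @ \oo --> (z : C^o).
Proof. by move=> h; rewrite -(cvg_shiftS (u : nat -> C^o)). Qed.

Lemma cvgc_conj u z : (u : nat -> C^o) @ \oo --> (z : C^o) ->
  ((fun n => (u n)^*) : nat -> C^o) @ \oo --> (z^* : C^o).
Proof.
move=> /cvgcP h; apply/cvgcP; apply: cvg_trans h; apply: near_eq_cvg.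
by apply: nearW => n; rewrite -rmorphB normc_conj.
Qed.

Lemma cvgcM u v z w : (u : nat -> C^o) @ \oo --> (z : C^o) ->
  (v : nat -> C^o) @ \oo --> (w : C^o) ->
  ((fun n => u n * v n) : nat -> C^o) @ \oo --> (z * w : C^o).
Proof. exact: (@cvgM C nat \oo _ u v z w). Qed.

Lemma cvgcD u v z w : (u : nat -> C^o) @ \oo --> (z : C^o) ->
  (v : nat -> C^o) @ \oo --> (w : C^o) ->
  ((fun n => u n + v n) : nat -> C^o) @ \oo --> (z + w : C^o).
Proof. exact: (@cvgD C C^o nat \oo _ u v z w). Qed.

Lemma cvgcB u v z w : (u : nat -> C^o) @ \oo --> (z : C^o) ->
  (v : nat -> C^o) @ \oo --> (w : C^o) ->
  ((fun n => u n - v n) : nat -> C^o) @ \oo --> (z - w : C^o).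
Proof. exact: (@cvgB C C^o nat \oo _ u v z w). Qed.

Lemma cvgcZ x u z : (u : nat -> C^o) @ \oo --> (z : C^o) ->
  ((fun n => x * u n) : nat -> C^o) @ \oo --> (x * z : C^o).
Proof. by apply: cvgcM; exact: cvg_cst. Qed.

Lemma seriesRe u n : complex.Re (series u n) = series (fun k => complex.Re (u k)) n.
Proof.
rewrite /series /=; elim: n => [|n IH]; first by rewrite !big_nil.
by rewrite !big_nat_recr //= ReD IH.
Qed.

Lemma seriesIm u n : complex.Im (series u n) = series (fun k => complex.Im (u k)) n.
Proof.
rewrite /series /=; elim: n => [|n IH]; first by rewrite !big_nil.
by rewrite !big_nat_recr //= ImD IH.
Qed.

Definition csum u : C := lim ((series u : nat -> C^o) @ \oo).

Lemma csum_eq u z : (series u : nat -> C^o) @ \oo --> (z : C^o) -> csum u = z.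
Proof. by move=> h; apply: (@cvg_lim C^o) => //; exact: norm_hausdorff. Qed.

(** Comparison for absolute convergence, applied to the two coordinates. *)
Lemma csum_cvg u (b : nat -> R) : (forall k, normc (u k) <= b k) ->
  cvgn (series b) -> (series u : nat -> C^o) @ \oo --> (csum u : C^o).
Proof.
move=> ub cb.
have ab (w : nat -> R) : (forall k, `|w k| <= normc (u k)) -> cvgn (series w).
  move=> wu; apply: normed_cvg; apply: (series_le_cvg _ _ _ cb) => k //=.
    by apply: le_trans (ub k); exact: normc_ge0.
  exact: le_trans (wu k) (ub k).
have /cvg_ex[x hx] : cvgn (series (fun k => complex.Re (u k))).
  by apply: ab => k; exact: normr_Re_le.
have /cvg_ex[y hy] : cvgn (series (fun k => complex.Im (u k))).
  by apply: ab => k; exact: normr_Im_le.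
have h : (series u : nat -> C^o) @ \oo --> (x +i* y : C^o).
  apply/cvg_ReIm; split => /=.
    by under eq_fun do rewrite seriesRe.
  by under eq_fun do rewrite seriesIm.
by rewrite (csum_eq h).
Qed.

Lemma csum_le u (b : nat -> R) : (forall k, normc (u k) <= b k) ->
  cvgn (series b) -> normc (csum u) <= limn (series b).
Proof.
move=> ub cb; have hu := csum_cvg ub cb.
have hn : normc (series u n) @[n --> \oo] --> normc (csum u).
  move/cvgcP/cvgrPdist_lt : hu => h; apply/cvgrPdist_lt => e /h.
  apply: filterS => n; rewrite distrC subr0 ger0_norm ?normc_ge0 //.
  by apply: le_lt_trans; rewrite distrC ler_dist_normc.
apply: (ler_cvg_to hn cb).
apply: nearW => n; rewrite /series /=; elim: n => [|n IH].
  by rewrite !big_nil normc0.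
by rewrite !big_nat_recr //= (le_trans (le_normcD _ _)) // lerD.
Qed.

End ComplexLimits.

(** * Square-summable sequences *)

Section SquareSummable.
Context {R : realType}.
Local Notation C := R[i].
Implicit Types (c d e : nat -> C).

Definition l2 c : Prop := cvgn (series (fun k => normc (c k) ^+ 2)).

Definition sqn c : R := limn (series (fun k => normc (c k) ^+ 2)).

Definition dot c d : C := csum (fun k => c k * (d k)^*).

Lemma series_sqr_nd c : nondecreasing_seq (series (fun k => normc (c k) ^+ 2)).
Proof. by apply: nondecreasing_series => k _ _; rewrite sqr_ge0. Qed.

Lemma l2_bounded c B :
  (forall n, series (fun k => normc (c k) ^+ 2) n <= B) -> l2 c.
Proof.
move=> hB; apply: nondecreasing_is_cvgn; first exact: series_sqr_nd.
by exists B => _ [n _ <-].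
Qed.

Lemma l2_le c (b : nat -> R) : (forall k, normc (c k) ^+ 2 <= b k) ->
  cvgn (series b) -> l2 c.
Proof.
move=> cb; apply: series_le_cvg => // k; rewrite ?sqr_ge0 //.
by apply: le_trans (cb k); rewrite sqr_ge0.
Qed.

Lemma series_le_sqn c n : l2 c -> series (fun k => normc (c k) ^+ 2) n <= sqn c.
Proof. by move=> hc; apply: (nondecreasing_cvgn_le (series_sqr_nd c) hc). Qed.

Lemma sqn_ge0 c : l2 c -> 0 <= sqn c.
Proof. by move=> /(@series_le_sqn _ 0); rewrite /series /= big_nil. Qed.

Lemma normcD_sqr (z w : C) :
  normc (z + w) ^+ 2 <= 2 * normc z ^+ 2 + 2 * normc w ^+ 2.
Proof.
apply: (@le_trans _ _ ((normc z + normc w) ^+ 2)).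
  by rewrite ler_pXn2r ?nnegrE ?addr_ge0 ?normc_ge0 // le_normcD.
by have := sqr_ge0 (normc z - normc w); rewrite !expr2; lra.
Qed.

Lemma cvg_seriesD (u v : nat -> R) : cvgn (series u) -> cvgn (series v) ->
  cvgn (series (fun k => u k + v k)).
Proof. by move=> hu hv; rewrite (_ : (fun k => _) = u + v) // seriesD; exact: is_cvgD. Qed.

Lemma cvg_seriesZ x (u : nat -> R) : cvgn (series u) ->
  cvgn (series (fun k => x * u k)).
Proof. by move=> hu; exact: is_cvg_seriesZ. Qed.

Lemma l2D c d : l2 c -> l2 d -> l2 (fun k => c k + d k).
Proof.
move=> hc hd; apply: (l2_le (fun k => normcD_sqr (c k) (d k))).
by apply: cvg_seriesD; exact: cvg_seriesZ.
Qed.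

Lemma l2Z x c : l2 c -> l2 (fun k => x * c k).
Proof.
move=> /(@cvg_seriesZ (normc x ^+ 2)); apply: l2_le => k.
by rewrite normcM exprMn.
Qed.

Lemma l2B c d : l2 c -> l2 d -> l2 (fun k => c k - d k).
Proof.
move=> hc hd; apply: l2D => //; rewrite (_ : (fun k => _) = fun k => -1 * d k).
  exact: l2Z.
by apply/funext => k; rewrite mulN1r.
Qed.

Lemma l20 : l2 (fun=> 0).
Proof.
by apply: (@l2_bounded _ 0) => n; rewrite /series /= big1 => [|k _];
  rewrite ?lexx // !expr0n addr0 sqrtr0 expr0n.
Qed.

Lemma l2_sum (I : Type) (s : seq I) (F : I -> nat -> C) :
  (forall i, l2 (F i)) -> l2 (fun k => \sum_(i <- s) F i k).
Proof.
move=> hF; elim: s => [|i s IH].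
  by under eq_fun do rewrite big_nil; exact: l20.
by under eq_fun do rewrite big_cons; exact: l2D.
Qed.

Lemma dot_bound c d k :
  normc (c k * (d k)^*) <= normc (c k) ^+ 2 + normc (d k) ^+ 2.
Proof.
rewrite normcM normc_conj.
have := sqr_ge0 (normc (c k) - normc (d k)).
have := mulr_ge0 (normc_ge0 (c k)) (normc_ge0 (d k)).
by rewrite !expr2; lra.
Qed.

Lemma dotP c d : l2 c -> l2 d ->
  (series (fun k => c k * (d k)^*) : nat -> C^o) @ \oo --> (dot c d : C^o).
Proof.
by move=> hc hd; apply: csum_cvg (dot_bound c d) _; exact: cvg_seriesD.
Qed.

Lemma dotDl c d e : l2 c -> l2 d -> l2 e ->
  dot (fun k => c k + d k) e = dot c e + dot d e.
Proof.
move=> hc hd he; apply: csum_eq; have := cvgcD (dotP hc he) (dotP hd he).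
apply: cvgc_eq => n.
by rewrite /series /= -big_split; apply: eq_bigr => k _; rewrite mulrDl.
Qed.

Lemma dotZl x c d : l2 c -> l2 d -> dot (fun k => x * c k) d = x * dot c d.
Proof.
move=> hc hd; apply: csum_eq; have := @cvgcZ _ x _ _ (dotP hc hd).
apply: cvgc_eq => n.
by rewrite /series /= mulr_sumr; apply: eq_bigr => k _; rewrite mulrA.
Qed.

Lemma dotC c d : l2 c -> l2 d -> dot d c = (dot c d)^*.
Proof.
move=> hc hd; apply: csum_eq; have := cvgc_conj (dotP hc hd).
apply: cvgc_eq => n.
rewrite /series /= rmorph_sum; apply: eq_bigr => k _ /=.
by rewrite rmorphM /= conjcK mulrC.
Qed.

Lemma dotDr c d e : l2 c -> l2 d -> l2 e ->
  dot e (fun k => c k + d k) = dot e c + dot e d.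
Proof.
move=> hc hd he; rewrite (@dotC (fun k => c k + d k)) //; last exact: l2D.
by rewrite dotDl // rmorphD /= -!dotC.
Qed.

Lemma dotZr x c d : l2 c -> l2 d -> dot d (fun k => x * c k) = x^* * dot d c.
Proof.
move=> hc hd; rewrite (@dotC (fun k => x * c k)) //; last exact: l2Z.
by rewrite dotZl // rmorphM /= -!dotC.
Qed.

Lemma dotBl c d e : l2 c -> l2 d -> l2 e ->
  dot (fun k => c k - d k) e = dot c e - dot d e.
Proof.
move=> hc hd he; rewrite (_ : (fun k => _) = fun k => c k + -1 * d k); last first.
  by apply/funext => k; rewrite mulN1r.
by rewrite (dotDl hc (@l2Z (-1) _ hd) he) (dotZl _ hd he) mulN1r.
Qed.

Lemma dotBr c d e : l2 c -> l2 d -> l2 e ->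
  dot e (fun k => c k - d k) = dot e c - dot e d.
Proof.
move=> hc hd he; rewrite (@dotC (fun k => c k - d k)) //; last exact: l2B.
by rewrite dotBl // rmorphB /= -!dotC.
Qed.

Lemma dot0l d : dot (fun=> 0) d = 0.
Proof.
apply: csum_eq; rewrite (_ : series _ = fun=> 0); first exact: cvg_cst.
by apply/funext => n; rewrite /series /= big1 // => k _; rewrite mul0r.
Qed.

Lemma dot_suml (I : Type) (s : seq I) (F : I -> nat -> C) d :
  (forall i, l2 (F i)) -> l2 d ->
  dot (fun k => \sum_(i <- s) F i k) d = \sum_(i <- s) dot (F i) d.
Proof.
move=> hF hd; elim: s => [|i s IH].
  by under eq_fun do rewrite big_nil; rewrite big_nil dot0l.
under eq_fun do rewrite big_cons; rewrite big_cons -IH dotDl //.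
exact: l2_sum.
Qed.

Lemma dotcc c : l2 c -> dot c c = (sqn c)%:C.
Proof.
move=> hc; apply: csum_eq; apply/cvg_ReIm; split => /=.
  under eq_fun do rewrite seriesRe.
  under [X in series X]eq_fun do rewrite mulcJ /=.
  exact: hc.
under eq_fun do rewrite seriesIm.
under [X in series X]eq_fun do rewrite mulcJ /=.
rewrite (_ : series _ = fun=> 0); first exact: cvg_cst.
by apply/funext => n; rewrite /series /= big1.
Qed.

Lemma sqnE c : l2 c -> sqn c = complex.Re (dot c c).
Proof. by move=> /dotcc ->. Qed.

(** The expansion of [0 <= |t c - d|^2]; leaving [t] free replaces the
Cauchy-Schwarz inequality. *)
Lemma Re_dot_le c d (t : R) : l2 c -> l2 d ->
  2 * t * complex.Re (dot c d) <= t ^+ 2 * sqn c + sqn d.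
Proof.
move=> hc hd; have htc := @l2Z t%:C _ hc.
have := sqn_ge0 (l2B htc hd); rewrite sqnE; last exact: l2B.
rewrite dotBl ?dotBr // ?dotZl ?dotZr ?dotcc //; try exact: l2B.
rewrite [dot d c]dotC //.
case: (dot c d) => x y; simpc => /=.
by rewrite expr2; lra.
Qed.

(** Multiplication by [z] on coefficient sequences. *)
Definition ushift c : nat -> C := fun k => if k is k'.+1 then c k' else 0.

Lemma series_shift (V : zmodType) (u v : nat -> V) n :
  u 0%N = 0 -> (forall k, u k.+1 = v k) -> series u n.+1 = series v n.
Proof.
by move=> u0 uv; rewrite /series /= big_nat_recl // u0 add0r; apply: eq_bigr.
Qed.

Lemma l2_ushift c : l2 c -> l2 (ushift c).
Proof.
move=> hc; apply: (@l2_bounded _ (sqn c)) => -[|n].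
  by rewrite /series /= big_nil sqn_ge0.
rewrite (@series_shift _ _ (fun k => normc (c k) ^+ 2)) //=.
  exact: series_le_sqn.
by rewrite !expr0n addr0 sqrtr0 expr0n.
Qed.

Lemma dot_ushift c d : l2 c -> l2 d -> dot (ushift c) (ushift d) = dot c d.
Proof.
move=> hc hd; apply: csum_eq; apply: cvgc_shiftS.
have := dotP hc hd; apply: cvgc_eq => n.
by rewrite (@series_shift _ _ (fun k => c k * (d k)^*)) //= mul0r.
Qed.

End SquareSummable.

(** * Power series with square-summable coefficients *)

Section PowerSeries.
Context {R : realType}.
Local Notation C := R[i].
Implicit Types (c d e : nat -> C) (f g : C -> C) (a z : C).

Definition ev c z : C := csum (fun k => c k * z ^+ k).

(** From [x y <= x^2 + y^2]: a majorant of [|c_k z^k|] that is uniform in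
[|z| <= r]. *)
Definition ev_bound c (r : R) : nat -> R :=
  fun k => normc (c k) ^+ 2 + geometric 1 (r ^+ 2) k.

Lemma cvg_ev_bound c (r : R) : l2 c -> 0 <= r -> r < 1 -> cvgn (series (ev_bound c r)).
Proof.
move=> hc r0 r1; apply: cvg_seriesD => //; apply: is_cvg_geometric_series.
by rewrite ger0_norm ?exprn_ge0 // expr_lt1.
Qed.

Lemma ev_boundP c z (r : R) k : normc z <= r -> normc (c k * z ^+ k) <= ev_bound c r k.
Proof.
move=> zr; rewrite normcM normc_exp /ev_bound /geometric /= mul1r exprAC.
have := sqr_ge0 (normc (c k) - r ^+ k).
have r0 : 0 <= r by exact: le_trans (normc_ge0 _) zr.
have h0 : 0 <= normc (c k) * r ^+ k by rewrite mulr_ge0 ?exprn_ge0 ?normc_ge0.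
have : normc (c k) * normc z ^+ k <= normc (c k) * r ^+ k.
  by rewrite ler_wpM2l ?normc_ge0 // lerXn2r ?nnegrE ?normc_ge0.
by rewrite !expr2; lra.
Qed.

Lemma evP c : l2 c -> has_taylor (ev c) c.
Proof.
move=> hc z /discP z1; apply: (@csum_cvg _ _ (ev_bound c (normc z))) => [k|].
  exact: ev_boundP.
exact: cvg_ev_bound (normc_ge0 z) z1.
Qed.

Lemma evE f c z : has_taylor f c -> disc z -> ev c z = f z.
Proof. by move=> hf hz; apply: csum_eq; exact: hf. Qed.

Lemma eq_has_taylor f g c : (forall z, disc z -> f z = g z) ->
  has_taylor f c -> has_taylor g c.
Proof. by move=> fg hf z hz; rewrite -fg //; exact: hf. Qed.

Lemma eq_has_taylor2 f g c d : (forall z, f z = g z) -> (forall k, c k = d k) ->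
  has_taylor f c -> has_taylor g d.
Proof. by move=> /funext -> /funext ->. Qed.

Lemma ev_le c z (r : R) : l2 c -> normc z <= r -> r < 1 ->
  normc (ev c z) <= sqn c + (1 - r ^+ 2)^-1.
Proof.
move=> hc zr r1; have r0 : 0 <= r by exact: le_trans (normc_ge0 _) zr.
have hb := cvg_ev_bound hc r0 r1.
apply: (le_trans (csum_le (fun k => ev_boundP c k zr) hb)).
have hg : `|r ^+ 2| < 1 by rewrite ger0_norm ?exprn_ge0 // expr_lt1.
have hl : series (ev_bound c r) @ \oo --> sqn c + 1 * (1 - r ^+ 2)^-1.
  rewrite (_ : ev_bound c r = (fun k => normc (c k) ^+ 2) + geometric 1 (r ^+ 2)) //.
  by rewrite seriesD; apply: cvgD; [exact: hc|exact: cvg_geometric_series].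
by rewrite (cvg_lim _ hl) // mul1r.
Qed.

Lemma has_taylorD f g c d : has_taylor f c -> has_taylor g d ->
  has_taylor (fun z => f z + g z) (fun k => c k + d k).
Proof.
move=> hf hg z hz; have := cvgcD (hf z hz) (hg z hz).
apply: cvgc_eq => n.
by rewrite /series /= -big_split; apply: eq_bigr => k _; rewrite mulrDl.
Qed.

Lemma has_taylorZ x f c : has_taylor f c ->
  has_taylor (fun z => x * f z) (fun k => x * c k).
Proof.
move=> hf z hz; have := @cvgcZ _ x _ _ (hf z hz).
apply: cvgc_eq => n.
by rewrite /series /= mulr_sumr; apply: eq_bigr => k _; rewrite mulrA.
Qed.

Lemma has_taylorB f g c d : has_taylor f c -> has_taylor g d ->
  has_taylor (fun z => f z - g z) (fun k => c k - d k).
Proof.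
move=> hf hg; have := has_taylorD hf (@has_taylorZ (-1) _ _ hg).
by apply: eq_has_taylor2 => [z|k]; rewrite mulN1r.
Qed.

Lemma has_taylor0 : has_taylor (fun=> 0 : C) (fun=> 0).
Proof.
move=> z _; rewrite (_ : series _ = fun=> 0); first exact: cvg_cst.
by apply/funext => n; rewrite /series /= big1 // => k _; rewrite mul0r.
Qed.

Lemma has_taylor_sum (I : Type) (s : seq I) (f : I -> C -> C) (F : I -> nat -> C) :
  (forall i, has_taylor (f i) (F i)) ->
  has_taylor (fun z => \sum_(i <- s) f i z) (fun k => \sum_(i <- s) F i k).
Proof.
move=> hF; elim: s => [|i s IH].
  by apply: eq_has_taylor2 has_taylor0 => [z|k]; rewrite big_nil.
by apply: eq_has_taylor2 (has_taylorD (hF i) IH) => [z|k]; rewrite big_cons.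
Qed.

Lemma has_taylor_ushift f c : has_taylor f c ->
  has_taylor (fun z => z * f z) (ushift c).
Proof.
move=> hf z hz; apply: cvgc_shiftS.
have := @cvgcZ _ z _ _ (hf z hz).
apply: cvgc_eq => n.
rewrite (@series_shift _ _ (fun k => z * (c k * z ^+ k))) /= ?mul0r //.
  by rewrite /series /= mulr_sumr.
by move=> k; rewrite exprS mulrCA.
Qed.

Definition behead_seq c : nat -> C := fun k => c k.+1.

Lemma l2_behead c : l2 c -> l2 (behead_seq c).
Proof.
move=> hc; apply: (@l2_bounded _ _ (sqn c)) => n.
apply: le_trans (series_le_sqn n.+1 hc).
by rewrite /series /= [leRHS]big_nat_recl //= lerDr sqr_ge0.
Qed.

Lemma sqn_behead c : l2 c -> sqn (behead_seq c) <= sqn c.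
Proof.
move=> hc; apply: limr_le; first exact: l2_behead.
apply: nearW => n; apply: le_trans (series_le_sqn n.+1 hc).
by rewrite /series /= [leRHS]big_nat_recl //= lerDr sqr_ge0.
Qed.

Lemma has_taylor_behead f c : l2 c -> has_taylor f c ->
  forall z, disc z -> f z = c 0%N + z * ev (behead_seq c) z.
Proof.
move=> hc hf z hz; apply: cvgc_unique (hf z hz) _.
apply: cvgc_shiftS.
have := cvgcD (@cvgc_cst _ (c 0%N)) (@cvgcZ _ z _ _ (evP (l2_behead hc) hz)).
apply: cvgc_eq => n.
rewrite /series /= big_nat_recl //= expr0 mulr1 mulr_sumr; congr (_ + _).
by apply: eq_bigr => k _; rewrite exprS mulrCA.
Qed.

(** The coefficients of [(f z - f a) / (z - a)], obtained by solving
[v_k = c_(k+1) + a v_(k+1)] forward along the tails of [c]. *)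
Definition diff_quo c a : nat -> C := fun k => ev (iter k.+1 behead_seq c) a.

Lemma l2_iter c n : l2 c -> l2 (iter n behead_seq c).
Proof. by move=> hc; elim: n => //= n; exact: l2_behead. Qed.

Lemma sqn_iter c n : l2 c -> sqn (iter n behead_seq c) <= sqn c.
Proof.
move=> hc; elim: n => //= n; apply: le_trans.
exact/sqn_behead/l2_iter.
Qed.

Lemma iter_behead c n k : iter n behead_seq c k = c (n + k)%N.
Proof. by elim: n k => //= n IH k; rewrite /behead_seq IH addnS. Qed.

Lemma diff_quo_rec c a k : l2 c -> disc a -> diff_quo c a k = c k.+1 + a * diff_quo c a k.+1.
Proof.
move=> hc ha; have hk := @l2_iter _ k.+1 hc.
rewrite {1}/diff_quo (has_taylor_behead hk (evP hk) ha).
by rewrite iter_behead addn0.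
Qed.

Lemma diff_quo_rec0 c a : l2 c -> disc a -> c 0%N + a * diff_quo c a 0 = ev c a.
Proof. by move=> hc ha; rewrite (has_taylor_behead hc (evP hc) ha). Qed.

(** Convexity of the square with weights [1 - s] and [s].  It sums along
first-order recursions with no division by [s], so that [s = 0] is covered. *)
Lemma normc_convex (s : R) (z w : C) : 0 <= s -> s < 1 ->
  (normc z + s * normc w) ^+ 2 <= normc z ^+ 2 / (1 - s) + s * normc w ^+ 2.
Proof.
move=> s0 s1; set x := normc z; set y := normc w.
have s1' : 0 < 1 - s by rewrite subr_gt0.
have -> : x ^+ 2 / (1 - s) + s * y ^+ 2 =
    (x + s * y) ^+ 2 + s * (x - (1 - s) * y) ^+ 2 / (1 - s).
  by field; rewrite gt_eqF.
rewrite lerDl; apply: divr_ge0; last exact: ltW.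
by apply: mulr_ge0 => //; exact: sqr_ge0.
Qed.

(** With [V] a partial sum of the squares of [v = diff_quo c a], convexity turns
the recursion into [V <= const + s (V + B^2)], where [B] bounds [v] and
[s = |a| < 1]. *)
Lemma l2_diff_quo c a : l2 c -> disc a -> l2 (diff_quo c a).
Proof.
move=> hc ha; have /discP a1 := ha; set s := normc a in a1.
have s0 : 0 <= s by exact: normc_ge0.
have s1' : 0 < 1 - s by rewrite subr_gt0.
set B := sqn c + (1 - s ^+ 2)^-1.
have hB k : normc (diff_quo c a k) ^+ 2 <= B ^+ 2.
  rewrite lerXn2r ?nnegrE ?normc_ge0 //.
    rewrite addr_ge0 ?sqn_ge0 // invr_ge0 subr_ge0 ltW // expr_lt1 //.
  apply: le_trans (ev_le (@l2_iter _ k.+1 hc) (lexx s) a1) _.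
  by rewrite lerD2r; exact: sqn_iter.
apply: (@l2_bounded _ _ ((sqn c / (1 - s) + s * B ^+ 2) / (1 - s))) => n.
rewrite ler_pdivlMr //; set V := series _ n.
suff : V <= sqn c / (1 - s) + s * (V + B ^+ 2) by lra.
apply: (@le_trans _ _ (series (fun k => normc (behead_seq c k) ^+ 2 / (1 - s)
    + s * normc (diff_quo c a k.+1) ^+ 2) n)).
  apply: ler_sum => k _; rewrite {1}diff_quo_rec //.
  apply: le_trans (normc_convex _ _ s0 a1).
  rewrite lerXn2r ?nnegrE ?addr_ge0 ?mulr_ge0 ?normc_ge0 //.
  by rewrite -normcM le_normcD.
rewrite /series /= big_split /= -mulr_suml -mulr_sumr lerD //.
  rewrite ler_wpM2r ?invr_ge0 ?(ltW s1') //.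
  exact: le_trans (series_le_sqn n (l2_behead hc)) (sqn_behead hc).
rewrite ler_wpM2l // (le_trans _ (lerD (lexx V) (hB n))) //.
rewrite /V /series /= -big_nat_recr //= big_nat_recl //= lerDr sqr_ge0 //.
Qed.

Lemma diff_quoP f c a : l2 c -> has_taylor f c -> disc a ->
  forall z, disc z -> f z = f a + (z - a) * ev (diff_quo c a) z.
Proof.
move=> hc hf ha z hz; have hq := l2_diff_quo hc ha.
have h := has_taylorB (has_taylor_ushift (evP hq)) (@has_taylorZ a _ _ (evP hq)).
have hs := l2B (l2_ushift hq) (@l2Z _ a _ hq).
have E := has_taylor_behead hs h hz.
rewrite (_ : behead_seq _ = behead_seq c) in E; last first.
  by apply/funext => k; rewrite /behead_seq /= diff_quo_rec // addrK.
rewrite mulrBl E (has_taylor_behead hc hf hz) -(evE hf ha) -(diff_quo_rec0 hc ha) /=.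
by ring.
Qed.

(** The difference quotient at [a] is again a power series with square-summable
coefficients, hence bounded near [a]. *)
Lemma ev_continuous c a : l2 c -> disc a ->
  {for (a : C^o), continuous (ev c : C^o -> C^o)}.
Proof.
move=> hc ha; have hq := l2_diff_quo hc ha; have /discP a1 := ha.
set r := (1 + normc a) / 2.
have r1 : r < 1 by rewrite /r; lra.
have ar : normc a < r by rewrite /r; lra.
set B := sqn (diff_quo c a) + (1 - r ^+ 2)^-1 + 1.
have B0 : 0 < B.
  rewrite ltr_wpDl // addr_ge0 ?sqn_ge0 // invr_ge0 subr_ge0 ltW // expr_lt1 //.
  exact: le_trans (normc_ge0 a) (ltW ar).
apply/(@cvgrPdist_lt C C^o C^o (nbhs (a : C^o)) _) => e; case: e => e y;
  rewrite ltcE /= => /andP[/eqP -> e0].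
have d0 : 0 < Num.min (r - normc a) (e / B) by rewrite lt_min subr_gt0 ar divr_gt0.
near=> z.
have : normc (a - z) < Num.min (r - normc a) (e / B).
  by near: z; exact: near_normc.
rewrite lt_min => /andP[h1 h2].
have zr : normc z < r.
  rewrite -(subrK a z) (le_lt_trans (le_normcD _ _)) // normc_subC.
  by move: h1; lra.
have hz : disc z by apply/discP; exact: lt_trans zr r1.
rewrite (diff_quoP hc (evP hc) ha hz) opprD addrA subrr sub0r normrN normrE ltcR.
rewrite normcM normc_subC (@le_lt_trans _ _ (normc (a - z) * B)) //.
  rewrite ler_wpM2l ?normc_ge0 // (le_trans (ev_le hq (ltW zr) r1)) // /B; lra.
by rewrite -ltr_pdivlMr.
Unshelve. all: by end_near. Qed.

(** Limits along punctured neighbourhoods are unique; this is how the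
continuity of a deflation at its removed singularity is exploited. *)
Lemma punctured_eq f g a : disc a ->
  {for (a : C^o), continuous (f : C^o -> C^o)} ->
  {for (a : C^o), continuous (g : C^o -> C^o)} ->
  (forall z, disc z -> z != a -> f z = g z) -> f a = g a.
Proof.
move=> ha /continuous_withinNx cf /continuous_withinNx cg fg.
apply: (@cvg_unique _ (@norm_hausdorff _ C^o) _ _ _ _ cf).
apply: cvg_trans cg; apply: near_eq_cvg.
have /discP a1 := ha.
near=> z.
rewrite fg //; last by near: z; exact: nbhs_dnbhs_neq.
have h : normc (a - z) < 1 - normc a.
  by near: z; apply: nbhs_dnbhs; apply: near_normc; rewrite subr_gt0.
apply/discP.
rewrite -(subrK a z) (le_lt_trans (le_normcD _ _)) // normc_subC.
by move: h; lra.
Unshelve. all: by end_near. Qed.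

Lemma disc0 : disc (0 : C).
Proof. by apply/discP; rewrite [normc _]normc0. Qed.

(** The constant term is the value at [0]; after division by [z] the value
at [0] is recovered by continuity, and the next coefficient vanishes in turn. *)
Lemma taylor0_l2 c : l2 c -> has_taylor (fun=> 0) c -> c = fun=> 0.
Proof.
move=> hc h0; apply/funext => n; rewrite -[n]addn0 -iter_behead.
have {h0} h0 : has_taylor (fun=> 0) (iter n behead_seq c).
  elim: n => //= n; set d := iter n _ c => hd.
  have ld : l2 d by exact: l2_iter.
  have lb := l2_behead ld.
  have h z : disc z -> z != 0 -> ev (behead_seq d) z = 0.
    move=> hz zn; have := has_taylor_behead ld hd hz.
    have := has_taylor_behead ld hd disc0.
    rewrite mul0r addr0 => <- /eqP; rewrite add0r eq_sym mulf_eq0 (negbTE zn).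
    by move/eqP.
  apply: eq_has_taylor (evP lb) => z hz; have [->|/h ->//] := eqVneq z 0.
  apply: (@punctured_eq _ (fun=> 0)) => //; first exact: disc0.
    exact: ev_continuous disc0.
  exact: (@cst_continuous C^o C^o).
have := has_taylor_behead (@l2_iter _ n hc) h0 disc0.
by rewrite mul0r addr0.
Qed.

(** Nothing is assumed on the growth of [c] and [d].  Convergence at [1/2] bounds
[|c_k - d_k| 2^-k], so rescaling by [1/4] gives square-summable coefficients. *)
Lemma has_taylor_unique f c d : has_taylor f c -> has_taylor f d -> c = d.
Proof.
move=> hc hd; have := has_taylorB hc hd.
set e := fun k => c k - d k => he.
suff e0 k : e k = 0 by apply/funext => k; apply/eqP; rewrite -subr_eq0 -/(e k) e0.
pose q : C := (4^-1)%:C.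
have hq : normc q = 4^-1 by rewrite normc_real ger0_norm // invr_ge0.
have he' z : disc z -> (series (fun k => e k * z ^+ k) : nat -> C^o) @ \oo --> (0 : C^o).
  by move=> hz; have := he z hz; rewrite subrr.
have h2 : disc ((2^-1)%:C : C).
  by apply/discP; rewrite normc_real ger0_norm ?invr_ge0 //; lra.
have [B [B0 hB]] : exists B : R, 0 <= B /\ forall k, normc (e k) * 2^-1 ^+ k <= B.
  have hc2 : cvgn (series (fun k => e k * (2^-1)%:C ^+ k) : nat -> C^o).
    by apply/cvg_ex; exists 0; exact: he'.
  have /cvgcP h0 := @cvg_series_cvg_0 _ C^o _ hc2.
  have [M [_ hM]] : bounded_fun (fun n => normc (e n * (2^-1)%:C ^+ n - 0)).
    by apply: cvg_seq_bounded; apply/cvg_ex; exists 0.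
  exists (`|M| + 1); split; first by rewrite addr_ge0.
  move=> j; have : `|normc (e j * (2^-1)%:C ^+ j - 0)| <= `|M| + 1.
    by apply: hM => //; rewrite (le_lt_trans (ler_norm M)) // ltrDl.
  by rewrite ger0_norm ?normc_ge0 // subr0 normcM normc_exp normc_real ger0_norm ?invr_ge0.
have le : l2 (fun k => e k * q ^+ k).
  apply: (@l2_le _ _ (geometric (B ^+ 2) (4^-1))).
    move=> j; rewrite normcM normc_exp hq /geometric /=.
    rewrite (_ : 4^-1 ^+ j = 2^-1 ^+ j * 2^-1 ^+ j :> R); last first.
      by rewrite -exprMn; congr (_ ^+ j); lra.
    rewrite mulrA exprMn -[X in _ <= _ * X]expr2 ler_wpM2r ?sqr_ge0 //.
    rewrite lerXn2r ?nnegrE ?mulr_ge0 ?normc_ge0 ?exprn_ge0 ?invr_ge0 //.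
  by apply: is_cvg_geometric_series; rewrite ger0_norm ?invr_ge0 //; lra.
have h0 : has_taylor (fun=> 0) (fun k => e k * q ^+ k).
  move=> z /discP hz.
  have /he' : disc (q * z).
    by apply/discP; rewrite normcM hq; have := normc_ge0 z; lra.
  apply: cvgc_eq => n.
  by rewrite /series /=; apply: eq_bigr => j _; rewrite exprMn mulrA.
have /(congr1 (fun u => u k))/= /eqP := taylor0_l2 le h0.
have q0 : q != 0.
  by apply/eqP => q0; move: hq; rewrite q0 [normc _]normc0; lra.
by rewrite mulf_eq0 expf_eq0 (negbTE q0) andbF orbF => /eqP.
Qed.

End PowerSeries.

(** * Trigonometric polynomials and Parseval's identity *)

Section TrigonometricPolynomials.
Context {R : realType}.
Local Notation C := R[i].
Local Notation mu := (@lebesgue_measure R).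
Local Notation D := (@circle_par R).
Implicit Types (c d e : nat -> C) (h : R -> R).

Definition trigpoly n c (t : R) : C := \sum_(k < n) c k * expi t ^+ k.

Lemma expiX t m : expi t ^+ m = expi (m%:R * t) :> C.
Proof.
elim: m => [|m IH]; first by rewrite expr0 mul0r /expi cos0 sin0.
rewrite exprS IH -natr1 mulrDl mul1r [_ + t]addrC /expi cosD sinD; simpc.
by congr (_ +i* _); ring.
Qed.

Lemma normc_expi t : normc (expi t : C) = 1.
Proof. by rewrite /expi /= cos2Dsin2 sqrtr1. Qed.

Lemma expi_shift t m k : (m <= k)%N ->
  expi t ^+ k * (expi t ^+ m)^* = expi t ^+ (k - m) :> C.
Proof.
move=> mk; rewrite -{1}(subnK mk) exprD -mulrA mulcJ normc_exp normc_expi.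
by rewrite !expr1n mulr1.
Qed.

(** Mean zero over a period, in the form of a periodic primitive: this is stable
under sums without any integrability condition. *)
Definition null_periodic_primitive h :=
  exists G : R -> R, (forall t, is_derive t (1 : R) G (h t)) /\ G (2 * pi) = G 0.

Lemma npp_cos_sin (x y : R) m : (0 < m)%N ->
  null_periodic_primitive (fun t => x * cos (m%:R * t) - y * sin (m%:R * t)).
Proof.
move=> m0; have mR : m%:R != 0 :> R by rewrite pnatr_eq0 -lt0n.
exists (fun t => x / m%:R * sin (m%:R * t) + y / m%:R * cos (m%:R * t)); split.
  move=> t.
  have hm : is_derive t (1 : R) (fun u : R => m%:R * u) m%:R.
    by apply: (is_derive_eq (is_deriveZ m%:R (is_derive_id t (1 : R)))); rewrite [LHS]mulr1.
  have hs : is_derive t (1 : R) (fun u => sin (m%:R * u)) (m%:R * cos (m%:R * t)).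
    by apply: (is_derive_eq (is_derive1_comp (is_derive_sin _) hm)); rewrite mulrC.
  have hc : is_derive t (1 : R) (fun u => cos (m%:R * u)) (- (m%:R * sin (m%:R * t))).
    by apply: (is_derive_eq (is_derive1_comp (is_derive_cos _) hm)); rewrite mulrC mulrN.
  apply: (is_derive_eq (is_deriveD (is_deriveZ (x / m%:R) hs) (is_deriveZ (y / m%:R) hc))).
  by rewrite /GRing.scale /=; field.
have h2 : m%:R * (2 * pi) = 0 + (pi *+ 2) *+ m :> R.
  by rewrite add0r !mulr_natl.
by rewrite h2 !periodicn ?mulr0 //; [exact: cosD2pi|exact: sinD2pi].
Qed.

Lemma nppD g h : null_periodic_primitive g -> null_periodic_primitive h ->
  null_periodic_primitive (fun t => g t + h t).
Proof.
move=> [G [hG G0]] [H [hH H0]]; exists (fun t => G t + H t); split.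
  by move=> t; exact: (is_deriveD (hG t) (hH t)).
by rewrite G0 H0.
Qed.

Lemma npp0 : null_periodic_primitive (fun=> 0).
Proof. by exists (fun=> 0); split => // t; exact: is_derive_cst. Qed.

Lemma npp_monomial (x : C) m : (0 < m)%N ->
  null_periodic_primitive (fun t => complex.Re (x * expi t ^+ m)).
Proof.
move=> m0; rewrite (_ : (fun t => _) = fun t =>
   complex.Re x * cos (m%:R * t) - complex.Im x * sin (m%:R * t)).
  exact: npp_cos_sin.
by apply/funext => t; rewrite expiX; case: x => x y; simpc.
Qed.

(** The product of a monomial of degree [n] and the conjugate of one of lower
degree has a nonzero frequency. *)
Lemma npp_cross c n (x : C) :
  null_periodic_primitive
    (fun t => 2 * complex.Re (x * expi t ^+ n * (trigpoly n c t)^*)).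
Proof.
suff h m : (m <= n)%N -> null_periodic_primitive
    (fun t => 2 * complex.Re (x * expi t ^+ n * (trigpoly m c t)^*)) by exact: h.
elim: m => [_|m IH mn].
  rewrite (_ : (fun t => _) = fun=> 0); first exact: npp0.
  by apply/funext => t; rewrite /trigpoly big_ord0 (rmorph0 conjc) mulr0 /= mulr0.
have := nppD (IH (ltnW mn)) (@npp_monomial ((2 : R)%:C * x * (c m)^*) (n - m) _).
rewrite subn_gt0 => /(_ mn); congr null_periodic_primitive; apply/funext => t.
rewrite -expi_shift ?(ltnW mn) // /trigpoly big_ord_recr /= (rmorphD conjc) /= mulrDr.
rewrite ReD mulrDr; congr (_ + _); rewrite rmorphM /=.
rewrite -!mulrA; set z := x * _; set w := x * _.
have -> : z = w by rewrite /z /w; ring.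
by case: w => u v; simpc.
Qed.

Lemma normcD2E (z w : C) :
  normc (z + w) ^+ 2 = normc z ^+ 2 + normc w ^+ 2 + 2 * complex.Re (w * z^*).
Proof.
rewrite !normc2E ReD ImD; case: z w => [u v] [p q] /=; simpc.
by rewrite /= !expr2; ring.
Qed.

(** Adding a monomial adds its own square and a cross term of mean zero. *)
Lemma npp_parseval c n : null_periodic_primitive
  (fun t => normc (trigpoly n c t) ^+ 2 - \sum_(k < n) normc (c k) ^+ 2).
Proof.
elim: n => [|n IH].
  rewrite (_ : (fun t => _) = fun=> 0); first exact: npp0.
  by apply/funext => t; rewrite /trigpoly !big_ord0 [normc _]normc0 expr0n subr0.
have := nppD IH (@npp_cross c n (c n)); congr null_periodic_primitive.
apply/funext => t; rewrite /trigpoly !big_ord_recr /= -/(trigpoly n c t).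
rewrite normcD2E normcM normc_exp normc_expi expr1n mulr1 -/(trigpoly n c t).
by ring.
Qed.

Lemma pi2_gt0 : 0 < 2 * pi :> R.
Proof. by rewrite mulr_gt0 // pi_gt0. Qed.

Lemma measurable_circle : measurable D.
Proof. exact: measurable_itv. Qed.

Definition cmeas (F : R -> C) :=
  measurable_fun D (fun t => complex.Re (F t)) /\
  measurable_fun D (fun t => complex.Im (F t)).

Lemma cmeasD F G : cmeas F -> cmeas G -> cmeas (fun t => F t + G t).
Proof.
move=> [hF1 hF2] [hG1 hG2]; split.
  by under eq_fun do rewrite ReD; exact: measurable_funD.
by under eq_fun do rewrite ImD; exact: measurable_funD.
Qed.

Lemma cmeasM F G : cmeas F -> cmeas G -> cmeas (fun t => F t * G t).
Proof.
move=> [hF1 hF2] [hG1 hG2]; split.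
  rewrite (_ : (fun t => _) = (fun t => complex.Re (F t) * complex.Re (G t) -
     complex.Im (F t) * complex.Im (G t))).
    by apply: measurable_funB; exact: measurable_funM.
  by apply/funext => t; case: (F t) (G t) => ? ? [? ?]; simpc.
rewrite (_ : (fun t => _) = (fun t => complex.Re (F t) * complex.Im (G t) +
     complex.Im (F t) * complex.Re (G t))).
  by apply: measurable_funD; exact: measurable_funM.
by apply/funext => t; case: (F t) (G t) => ? ? [? ?]; simpc.
Qed.

Lemma cmeas_cst (x : C) : cmeas (fun=> x).
Proof. by split; exact: measurable_cst. Qed.

Lemma cmeasZ x F : cmeas F -> cmeas (fun t => x * F t).
Proof. by apply: cmeasM; exact: cmeas_cst. Qed.

Lemma cmeasB F G : cmeas F -> cmeas G -> cmeas (fun t => F t - G t).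
Proof.
move=> hF /(@cmeasZ (-1)) hG; have := cmeasD hF hG.
by under eq_fun do rewrite mulN1r.
Qed.

Definition ccont (F : R -> C) :=
  continuous (fun t => complex.Re (F t)) /\ continuous (fun t => complex.Im (F t)).

Lemma ccontD F G : ccont F -> ccont G -> ccont (fun t => F t + G t).
Proof.
move=> [hF1 hF2] [hG1 hG2]; split => t.
  by under eq_fun do rewrite ReD; apply: cvgD; [exact: hF1|exact: hG1].
by under eq_fun do rewrite ImD; apply: cvgD; [exact: hF2|exact: hG2].
Qed.

Lemma ccontM F G : ccont F -> ccont G -> ccont (fun t => F t * G t).
Proof.
move=> [hF1 hF2] [hG1 hG2]; split.
  rewrite (_ : (fun t => _) = (fun t => complex.Re (F t) * complex.Re (G t) -
     complex.Im (F t) * complex.Im (G t))).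
    by move=> t; apply: cvgB; apply: cvgM; [exact: hF1|exact: hG1|exact: hF2|exact: hG2].
  by apply/funext => t; case: (F t) (G t) => ? ? [? ?]; simpc.
rewrite (_ : (fun t => _) = (fun t => complex.Re (F t) * complex.Im (G t) +
     complex.Im (F t) * complex.Re (G t))).
  by move=> t; apply: cvgD; apply: cvgM; [exact: hF1|exact: hG2|exact: hF2|exact: hG1].
by apply/funext => t; case: (F t) (G t) => ? ? [? ?]; simpc.
Qed.

Lemma ccont_cst (x : C) : ccont (fun=> x).
Proof. by split; exact: cst_continuous. Qed.

Lemma ccont_trigpoly n c : ccont (trigpoly n c).
Proof.
rewrite /trigpoly; elim: n => [|n IH].
  by under eq_fun do rewrite big_ord0; exact: ccont_cst.
under eq_fun do rewrite big_ord_recr; apply: ccontD => //.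
apply: ccontM; first exact: ccont_cst.
elim: n {IH} => [|n IH].
  by under eq_fun do rewrite expr0; exact: ccont_cst.
under eq_fun do rewrite exprS; apply: ccontM => //.
by split; [exact: continuous_cos|exact: continuous_sin].
Qed.

Lemma cmeas_ccont F : ccont F -> cmeas F.
Proof.
by move=> [h1 h2]; split; apply: measurable_funTS; exact: continuous_measurable_fun.
Qed.

Lemma cmeas_trigpoly n c : cmeas (trigpoly n c).
Proof. exact/cmeas_ccont/ccont_trigpoly. Qed.

Lemma cmeas_normc2 F : cmeas F -> measurable_fun D (fun t => normc (F t) ^+ 2).
Proof.
move=> [h1 h2]; under eq_fun do rewrite normc2E.
by apply: measurable_funD; exact: measurable_funX.
Qed.

Definition circle_sq (F : R -> C) : \bar R :=
  (\int[mu]_(t in D) (normc (F t) ^+ 2)%:E)%E.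

Lemma parseval_trigpoly n c :
  circle_sq (trigpoly n c) = (2 * pi * \sum_(k < n) normc (c k) ^+ 2)%:E.
Proof.
have [G [hG G0]] := npp_parseval c n.
set S := \sum_(k < n) _ in hG *.
have hH t : is_derive t (1 : R) (fun u => G u + S * u) (normc (trigpoly n c t) ^+ 2).
  apply: (is_derive_eq (is_deriveD (hG t) (is_deriveZ S (is_derive_id t (1 : R))))).
  by rewrite /GRing.scale /= mulr1 subrK.
have cH : continuous (fun u => G u + S * u).
  by move=> t; apply: differentiable_continuous; apply/derivable1_diffP; have [] := hH t.
rewrite /circle_sq (@continuous_FTC2 _ _ (fun u => G u + S * u)) ?pi2_gt0 //.
- by rewrite -EFinB G0 mulr0 addr0; congr EFin; ring.
- apply: continuous_subspaceT => t; have [h1 h2] := ccont_trigpoly n c.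
  under eq_fun do rewrite normc2E.
  by apply: cvgD; apply: cvgM; [exact: h1|exact: h1|exact: h2|exact: h2].
- split => [t _||].
  + by have [] := hH t.
  + by apply: cvg_at_right_filter; exact: cH.
  + by apply: cvg_at_left_filter; exact: cH.
- by move=> t _; rewrite derive1E; have [_ ->] := hH t.
Qed.

End TrigonometricPolynomials.

(** * Square integrals over the circle *)

Section CircleL2.
Context {R : realType}.
Local Notation C := R[i].
Local Notation mu := (@lebesgue_measure R).
Local Notation D := (@circle_par R).
Implicit Types (c d e : nat -> C) (F G H : R -> C).

Lemma circle_sq_ge0 F : (0 <= circle_sq F)%E.
Proof. by apply: integral_ge0 => t _; rewrite lee_fin sqr_ge0. Qed.

Lemma emeas_normc2 F : cmeas F -> measurable_fun D (fun t => (normc (F t) ^+ 2)%:E).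
Proof. by move=> hF; apply/measurable_EFinP; exact: cmeas_normc2. Qed.

(** Together with elementary bounds for [|z + w|^2] this does the work of the
triangle inequality in [L^2]. *)
Lemma circle_sq_le2 F G H (x y : R) : cmeas F -> cmeas G -> cmeas H ->
  0 <= x -> 0 <= y ->
  (forall t, normc (F t) ^+ 2 <= x * normc (G t) ^+ 2 + y * normc (H t) ^+ 2) ->
  (circle_sq F <= x%:E * circle_sq G + y%:E * circle_sq H)%E.
Proof.
move=> hF hG hH x0 y0 hFGH; have mD := @measurable_circle R.
have nn (K : R -> C) t : (0 <= (normc (K t) ^+ 2)%:E)%E by rewrite lee_fin sqr_ge0.
have h (z : R) (K : R -> C) : 0 <= z -> cmeas K ->
    (z%:E * circle_sq K = \int[mu]_(t in D) (z%:E * (normc (K t) ^+ 2)%:E))%E.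
  move=> z0 hK; by rewrite ge0_integralZl_EFin // => *; exact: emeas_normc2.
have m (z : R) (K : R -> C) : cmeas K -> measurable_fun D
  (fun t => (z%:E * (normc (K t) ^+ 2)%:E)%E).
  by move=> hK; apply: measurable_funeM; exact: emeas_normc2.
have p (z : R) (K : R -> C) : 0 <= z -> forall t, D t -> (0 <= z%:E * (normc (K t) ^+ 2)%:E)%E.
  by move=> z0 t _; rewrite mule_ge0 // lee_fin.
rewrite !h // -(ge0_integralD mu mD (p x G x0) (m x G hG) (p y H y0) (m y H hH)).
rewrite /circle_sq; apply: (ge0_le_integral mu mD (fun t _ => nn F t) (emeas_normc2 hF)).
- by apply: emeasurable_funD; exact: m.
- by move=> t _; rewrite -!EFinM -EFinD lee_fin.
Qed.

Lemma circle_sqD F G : cmeas F -> cmeas G ->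
  (circle_sq (fun t => (F t + G t)%R) <= 2%:E * circle_sq F + 2%:E * circle_sq G)%E.
Proof.
move=> hF hG; apply: circle_sq_le2 => //; first exact: cmeasD.
by move=> t; exact: normcD_sqr.
Qed.

Lemma cvgc_normc2 (u : nat -> C) z : (u : nat -> C^o) @ \oo --> (z : C^o) ->
  normc (u n) ^+ 2 @[n --> \oo] --> normc z ^+ 2.
Proof.
move=> /cvg_ReIm[hr hi]; under eq_fun do rewrite normc2E; rewrite normc2E.
by apply: cvgD; apply: cvgM.
Qed.

Lemma limn_einf_le (u : nat -> \bar R) (b : \bar R) :
  (forall n, (u n <= b)%E) -> (limn_einf u <= b)%E.
Proof.
move=> ub; rewrite limn_einf_lim; apply: lime_le; first exact: is_cvg_einfs.
apply: nearW => n; apply: le_trans (ub n); apply: ereal_inf_lbound.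
by exists n => /=.
Qed.

(** Fatou's lemma for squares.  It extends to infinite series the bounds that
Parseval's identity gives for trigonometric polynomials. *)
Lemma circle_sq_lim (F : nat -> R -> C) G (Z : set R) (b : \bar R) :
  (forall n, cmeas (F n)) -> cmeas G -> measurable Z -> mu Z = 0%E ->
  (forall t, D t -> ~ Z t -> ((fun n => F n t) : nat -> C^o) @ \oo --> (G t : C^o)) ->
  (forall n, (circle_sq (F n) <= b)%E) -> (circle_sq G <= b)%E.
Proof.
move=> hF hG mZ Z0 hFG hb; have mD := @measurable_circle R.
have mDZ : measurable (D `\` Z) by exact: measurableD.
have nn (K : R -> C) t : (0 <= (normc (K t) ^+ 2)%:E)%E by rewrite lee_fin sqr_ge0.
have mDZf K : cmeas K -> measurable_fun (D `\` Z) (fun t => (normc (K t) ^+ 2)%:E).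
  move=> /emeas_normc2; apply: measurable_funS => //; exact: subDsetl.
rewrite /circle_sq (@ge0_negligible_integral _ _ _ mu _ _ _ mZ mD (emeas_normc2 hG)
  (fun t _ => nn G t) Z0).
rewrite (_ : integral _ _ _ = (\int[mu]_(t in D `\` Z)
    limn_einf (fun n => (normc (F n t) ^+ 2)%:E))%E); last first.
  apply: eq_integral => t; rewrite inE => -[Dt Zt].
  have hc : (normc (F n t) ^+ 2)%:E @[n --> \oo] --> (normc (G t) ^+ 2)%:E.
    by apply: cvg_EFin; [exact: nearW|exact: cvgc_normc2 (hFG t Dt Zt)].
  by rewrite (cvg_limn_einf_sup hc).1.
apply: (le_trans (fatou mu mDZ (fun n => mDZf _ (hF n)) (fun n t _ => nn (F n) t))).
apply: limn_einf_le => n; apply: le_trans (hb n).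
by apply: ge0_subset_integral => // => *; exact: emeas_normc2.
Qed.

Lemma cmeas_lim (F : nat -> R -> C) G : (forall n, cmeas (F n)) ->
  (forall t, D t -> ((fun n => F n t) : nat -> C^o) @ \oo --> (G t : C^o)) -> cmeas G.
Proof.
move=> hF hFG; split; apply: measurable_fun_cvg.
- by move=> n; have [h _] := hF n; exact: h.
- by move=> t /hFG/cvg_ReIm[].
- by move=> n; have [_ h] := hF n; exact: h.
- by move=> t /hFG/cvg_ReIm[].
Qed.

Definition dilate (f : C -> C) (r t : R) : C := f (r%:C * expi t).

Definition dilate_seq c (r : R) : nat -> C := fun k => c k * r%:C ^+ k.

Lemma disc_dilate (r t : R) : 0 <= r -> r < 1 -> disc (r%:C * expi t).
Proof.
by move=> r0 r1; apply/discP; rewrite normcM normc_real normc_expi mulr1 ger0_norm.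
Qed.

Lemma trigpoly_dilate f c (r t : R) : has_taylor f c -> 0 <= r -> r < 1 ->
  ((fun n => trigpoly n (dilate_seq c r) t) : nat -> C^o) @ \oo --> (dilate f r t : C^o).
Proof.
move=> hf r0 r1; have := hf _ (disc_dilate t r0 r1); apply: cvgc_eq => n.
rewrite /series /trigpoly /= big_mkord; apply: eq_bigr => k _.
by rewrite exprMn mulrA.
Qed.

Lemma cmeas_dilate f c (r : R) : has_taylor f c -> 0 <= r -> r < 1 ->
  cmeas (dilate f r).
Proof.
move=> hf r0 r1; apply: (@cmeas_lim (fun n => trigpoly n (dilate_seq c r))).
  by move=> n; exact: cmeas_trigpoly.
by move=> t _; exact: trigpoly_dilate.
Qed.

Lemma trigpolyB n c d t : trigpoly n c t - trigpoly n d t = trigpoly n (fun k => c k - d k) t.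
Proof. by rewrite /trigpoly -sumrB; apply: eq_bigr => k _; rewrite mulrBl. Qed.

Definition truncate n c : nat -> C := fun k => if (k < n)%N then c k else 0.

Lemma trigpoly_truncate n m c t : (n <= m)%N -> trigpoly m (truncate n c) t = trigpoly n c t.
Proof.
move=> nm; rewrite /trigpoly (big_ord_widen _ (fun k => c k * expi t ^+ k) nm).
rewrite [RHS]big_mkcond /=; apply: eq_bigr => k _; rewrite /truncate.
by case: ifP => // _; rewrite mul0r.
Qed.

Lemma cvgn_tail c : l2 c -> forall e : R, 0 < e ->
  exists n, sqn c - series (fun k => normc (c k) ^+ 2) n < e.
Proof.
move=> hc e e0; have /cvgrPdist_lt/(_ e e0)[n _ /(_ n (leqnn n)) h] := hc.
by exists n; apply: le_lt_trans h; rewrite ler_norm.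
Qed.

End CircleL2.

(** * The Riesz-Fischer construction *)

Section RieszFischer.
Context {R : realType}.
Local Notation C := R[i].
Local Notation mu := (@lebesgue_measure R).
Local Notation D := (@circle_par R).
Implicit Types (c d e : nat -> C) (F G H : R -> C).

Definition l2_tail c n : R := sqn c - series (fun k => normc (c k) ^+ 2) n.

Lemma l2_tail_ge0 c n : l2 c -> 0 <= l2_tail c n.
Proof. by move=> hc; rewrite subr_ge0 series_le_sqn. Qed.

Lemma l2_tail_le c n m : (n <= m)%N -> l2_tail c m <= l2_tail c n.
Proof. by move=> nm; rewrite lerD2l lerN2; exact: series_sqr_nd. Qed.

(** Separates finitely many terms, in which limits are taken one by one, from a
tail that is uniformly small. *)
Lemma sum_head_tail c (u v : nat -> R) n m : l2 c ->
  (forall k, 0 <= u k) -> (forall k, (k < n)%N -> u k <= v k) ->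
  (forall k, (n <= k)%N -> u k <= normc (c k) ^+ 2) ->
  \sum_(k < m) u k <= \sum_(k < n) v k + l2_tail c n.
Proof.
move=> hc u0 uv uc; apply: (@le_trans _ _ (\sum_(0 <= k < m + n) u k)).
  rewrite -(big_mkord xpredT) (@big_cat_nat _ _ _ m 0 (m + n)) ?leq_addr //= lerDl.
  exact: sumr_ge0.
rewrite (@big_cat_nat _ _ _ n 0 (m + n)) ?leq_addl //= lerD //.
  by rewrite big_mkord; apply: ler_sum => k _; exact: uv.
rewrite lerBrDl; apply: le_trans (series_le_sqn (m + n) hc).
rewrite /series /= [leRHS](@big_cat_nat _ _ _ n 0 (m + n)) ?leq_addl //= lerD2l.
by rewrite !big_nat; apply: ler_sum => k /andP[nk _]; exact: uc.
Qed.

Lemma circle_sq_truncate c n m : l2 c ->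
  (circle_sq (trigpoly m (fun k => (c k - truncate n c k)%R)) <= (2 * pi * l2_tail c n)%:E)%E.
Proof.
move=> hc; rewrite parseval_trigpoly lee_fin ler_wpM2l ?(ltW (pi2_gt0)) //.
have -> : l2_tail c n = \sum_(k < n) (0 : R) + l2_tail c n by rewrite big1 ?add0r.
apply: (@sum_head_tail c (fun k => normc (c k - truncate n c k) ^+ 2) (fun=> 0)) => // k;
  first exact: sqr_ge0.
  by rewrite /truncate => ->; rewrite subrr [normc _]normc0 expr0n.
by rewrite /truncate ltnNge => -> /=; rewrite subr0.
Qed.

Lemma trigpoly_step c n m t : (n <= m)%N ->
  trigpoly m c t = trigpoly n c t + trigpoly m (fun k => c k - truncate n c k) t.
Proof. by move=> nm; rewrite -trigpolyB trigpoly_truncate // addrC subrK. Qed.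

(** The rate [8^-j] leaves room for the weights [4^j] of the next lemma. *)
Lemma fast_tail c : l2 c -> exists N : nat -> nat,
  [/\ forall j, (j <= N j)%N, forall j, (N j <= N j.+1)%N
    & forall j, l2_tail c (N j) <= 8^-1 ^+ j].
Proof.
move=> hc; have /choice[N hN] : forall j, exists n, l2_tail c n < 8^-1 ^+ j.
  by move=> j; apply: cvgn_tail => //; rewrite exprn_gt0 ?invr_gt0.
exists (fun j => (\sum_(i < j.+1) N i + j)%N); split => j.
- exact: leq_addl.
- by rewrite [in leqRHS]big_ord_recr /= -addnA leq_add2l (leq_trans (leqnSn j)) // leq_addl.
- apply: le_trans (ltW (hN j)); apply: l2_tail_le.
  by rewrite big_ord_recr /= -addnA addnCA leq_addr.
Qed.

(** Along indices with fast decaying tails, the square integrals of the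
increments, weighted by [4^j], have a finite sum.  So the weighted sum of their
squares is finite almost everywhere, and there the increments are [O(2^-j)]. *)
Lemma ae_limit c : l2 c -> exists (N : nat -> nat) (Z : set R) (F : R -> C),
  [/\ forall j, (j <= N j)%N, measurable Z, mu Z = 0%E, cmeas F
    & forall t, D t -> ~ Z t ->
      ((fun j => trigpoly (N j) c t) : nat -> C^o) @ \oo --> (F t : C^o)].
Proof.
move=> hc; have [N [jN NS hN]] := fast_tail hc.
pose d j t := trigpoly (N j.+1) (fun k => c k - truncate (N j) c k) t.
have pS j t : trigpoly (N j.+1) c t = trigpoly (N j) c t + d j t by exact: trigpoly_step.
have md j : cmeas (d j) by exact: cmeas_trigpoly.
have mD := @measurable_circle R.
pose w j t := ((4 ^+ j)%:E * (normc (d j t) ^+ 2)%:E)%E.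
have w0 j t : (0 <= w j t)%E by apply: mule_ge0; rewrite lee_fin; [exact: exprn_ge0|exact: sqr_ge0].
have mw j : measurable_fun D (w j).
  by apply: measurable_funeM; exact: emeas_normc2.
pose W t := (\sum_(0 <= j <oo) w j t)%E.
have mW : measurable_fun D W.
  by apply: ge0_emeasurable_sum.
have iW : (\int[mu]_(t in D) W t <= (2 * pi * 2)%:E)%E.
  rewrite /W (integral_nneseries mu mD mw (fun j t _ => w0 j t)).
  apply: lime_le.
    by apply: is_cvg_nneseries => j _ _; apply: integral_ge0 => t _; exact: w0.
  apply: nearW => n.
  apply: (@le_trans _ _ (\sum_(0 <= j < n) (2 * pi * 2^-1 ^+ j)%:E)%E).
    apply: lee_sum => j _; rewrite /w ge0_integralZl_EFin ?exprn_ge0 //.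
    - have h4 : (0 <= (4 ^+ j : R)%:E)%E by rewrite lee_fin exprn_ge0.
      apply: (le_trans (lee_wpmul2l h4 (circle_sq_truncate (N j) (N j.+1) hc))).
      rewrite -EFinM lee_fin mulrCA ler_wpM2l ?(ltW pi2_gt0) //.
      apply: (le_trans (ler_wpM2l (exprn_ge0 j (ler0n R 4)) (hN j))).
      by rewrite -exprMn lerXn2r ?nnegrE //; lra.
    - by move=> t _; rewrite lee_fin sqr_ge0.
    - exact: emeas_normc2.
  rewrite sumEFin lee_fin -mulr_sumr ler_wpM2l ?(ltW pi2_gt0) //.
  suff -> : \sum_(0 <= j < n) 2^-1 ^+ j = 2 - 2 * 2^-1 ^+ n :> R.
    by rewrite lerBlDr lerDl mulr_ge0 // exprn_ge0 // invr_ge0.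
  elim: n => [|n IH]; first by rewrite big_nil expr0; lra.
  by rewrite big_nat_recr //= IH exprS; lra.
pose Z := D `&` W @^-1` [set +oo%E].
have mZ : measurable Z by apply: mW => //; exact: emeasurable_set1.
have Z0 : mu Z = 0%E.
  have iWD : mu.-integrable D W.
    apply/integrableP; split => //.
    under eq_integral do rewrite gee0_abs ?nneseries_ge0 //.
    by apply: le_lt_trans iW _; rewrite ltry.
  apply/(@negligibleP _ _ _ mu) => //.
  have := @integrable_ae _ _ _ mu _ mD _ iWD; apply: negligibleS => t [Dt /= Wt] /(_ Dt).
  by rewrite Wt.
have hd t : D t -> ~ Z t -> exists B : R, forall j, normc (d j t) <= geometric B 2^-1 j.
  move=> Dt nZ; have W0 : (0 <= W t)%E by exact: nneseries_ge0.
  have Wfin : W t \is a fin_num.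
    by rewrite ge0_fin_numE // ltey; apply/eqP => Wt; apply: nZ.
  exists (fine (W t) + 1) => j.
  have : (w j t <= W t)%E.
    have := @nneseries_lim_ge _ (fun j => w j t) xpredT 0 j.+1 (fun j _ _ => w0 j t).
    apply: le_trans; rewrite big_nat_recr //= leeDr // sume_ge0 // => i _; exact: w0.
  rewrite -(fineK Wfin) /w -EFinM lee_fin => hw.
  have W0' : 0 <= fine (W t) by exact: fine_ge0.
  rewrite /geometric /= exprVn ler_pdivlMr ?exprn_gt0 // mulrC.
  rewrite -(@ler_pXn2r _ 2%N) ?nnegrE ?addr_ge0 ?mulr_ge0 ?exprn_ge0 ?normc_ge0 //.
  rewrite exprMn -exprM mulnC exprM (_ : 2 ^+ 2 = 4) //; last by rewrite expr2; lra.
  by apply: le_trans hw _; rewrite expr2; nra.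
pose F t : C := (\1_(~` Z) t)%:C * (trigpoly (N 0) c t + csum (fun j => d j t)).
have hF t : D t -> ~ Z t ->
    ((fun j => trigpoly (N j) c t) : nat -> C^o) @ \oo --> (F t : C^o).
  move=> Dt nZ; have [B hB] := hd t Dt nZ.
  rewrite /F indicE mem_set // mul1r.
  have hg : cvgn (series (geometric B (2^-1 : R))).
    by apply: is_cvg_geometric_series; rewrite ger0_norm ?invr_ge0 //; lra.
  have := cvgcD (@cvgc_cst _ (trigpoly (N 0) c t)) (csum_cvg hB hg).
  apply: cvgc_eq => n; rewrite /series /=; elim: n => [|n IH].
    by rewrite big_nil addr0.
  by rewrite big_nat_recr //= addrA IH pS.
exists N, Z, F; split => //.
apply: (@cmeas_lim _ (fun j t => (\1_(~` Z) t)%:C * trigpoly (N j) c t)).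
  move=> j; apply: cmeasM; last exact: cmeas_trigpoly.
  split => /=; last exact: measurable_cst.
  by apply: measurable_indic; exact: measurableC.
move=> t Dt; have [Zt|nZ] := pselect (Z t).
  rewrite /F indicE memNset; last by apply.
  by rewrite mul0r; apply: cvgc_eq (@cvgc_cst _ 0) => n; rewrite mul0r.
apply: cvgc_eq (hF t Dt nZ) => j.
by rewrite indicE mem_set // mul1r.
Qed.

End RieszFischer.

(** * Boundary functions and the inner product *)

Section Boundary.
Context {R : realType}.
Local Notation C := R[i].
Local Notation mu := (@lebesgue_measure R).
Local Notation D := (@circle_par R).
Implicit Types (c d : nat -> C) (F G H : R -> C) (f g : C -> C).

Lemma cvgc_sub (u : nat -> C) (N : nat -> nat) z : (forall j, (j <= N j)%N) ->
  (u : nat -> C^o) @ \oo --> (z : C^o) -> ((fun j => u (N j)) : nat -> C^o) @ \oo --> (z : C^o).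
Proof.
move=> jN hu; apply: (cvg_comp N (u : nat -> C^o)) hu.
by move=> P [n _ hn]; exists n => // j /= nj; apply: hn; exact: leq_trans (jN j).
Qed.

(** The squared distance between the first [n] coefficients of a function and
those of its dilate by [r]. *)
Definition dilation_defect c n (r : R) : R := \sum_(k < n) normc (c k) ^+ 2 * (1 - r ^+ k) ^+ 2.

Lemma dilation_defect_cvg c n : dilation_defect c n r @[r --> 1^'-] --> 0.
Proof.
apply: cvg_at_left_filter.
rewrite (_ : 0 = dilation_defect c n 1); last first.
  by rewrite /dilation_defect big1 // => k _; rewrite expr1n subrr expr0n mulr0.
elim: n => [|n IH].
  by rewrite /dilation_defect; under eq_fun do rewrite big_ord0; rewrite big_ord0; exact: cvg_cst.
rewrite /dilation_defect; under eq_fun do rewrite big_ord_recr; rewrite big_ord_recr /=.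
apply: cvgD; first exact: IH.
apply: cvgM; first exact: cvg_cst.
by apply: cvgM; (apply: cvgB; [exact: cvg_cst|exact: exprn_continuous]).
Qed.

Lemma cvge0P (u : R -> \bar R) : (forall r, (0 <= u r)%E) ->
  (forall e : R, 0 < e -> \forall r \near 1^'-, (u r <= e%:E)%E) ->
  u r @[r --> 1^'-] --> 0%E.
Proof.
move=> u0 hu; apply/fine_cvgP; split.
  have := hu 1 ltr01; apply: filterS => r hr.
  by rewrite ge0_fin_numE // (le_lt_trans hr) // ltry.
apply/cvgrPdist_le => e /hu; apply: filterS => r hr /=.
have ufin : u r \is a fin_num by rewrite ge0_fin_numE // (le_lt_trans hr) // ltry.
by rewrite sub0r normrN ger0_norm ?fine_ge0 // -lee_fin fineK.
Qed.

Lemma near_left1 : \forall r \near (1 : R)^'-, 0 <= r < 1.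
Proof.
near=> r; apply/andP; split; last by near: r; exact: nbhs_left_lt.
by apply: ltW; near: r; apply: nbhs_left_gt.
Unshelve. all: by end_near. Qed.

Lemma sum_dilate_le c n m (r : R) : l2 c -> 0 <= r < 1 ->
  \sum_(k < m) normc (dilate_seq c r k - c k) ^+ 2 <= dilation_defect c n r + l2_tail c n.
Proof.
move=> hc /andP[r0 r1].
have h k : normc (dilate_seq c r k - c k) ^+ 2 = normc (c k) ^+ 2 * (1 - r ^+ k) ^+ 2.
  rewrite /dilate_seq -{2}[c k]mulr1 -mulrBr normcM exprMn; congr (_ * _).
  by rewrite -rmorphXn -[1]/(1%:C) -rmorphB normc_real real_normK ?num_real // -sqrrN opprB.
apply: (@sum_head_tail _ _ (fun k => normc (dilate_seq c r k - c k) ^+ 2)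
   (fun k => normc (c k) ^+ 2 * (1 - r ^+ k) ^+ 2)) => // k.
- exact: sqr_ge0.
- by rewrite h.
rewrite h => _; rewrite ler_piMr ?sqr_ge0 // expr_le1 //.
  by rewrite lerBlDr lerDl exprn_ge0.
by rewrite subr_ge0 exprn_ile1 // ltW.
Qed.

Lemma sum_dilate_truncate_le c n m (r : R) : l2 c -> 0 <= r < 1 ->
  \sum_(k < m) normc (dilate_seq c r k - truncate n c k) ^+ 2 <=
    dilation_defect c n r + l2_tail c n.
Proof.
move=> hc /andP[r0 r1].
apply: (@sum_head_tail _ _ (fun k => normc (dilate_seq c r k - truncate n c k) ^+ 2)
   (fun k => normc (c k) ^+ 2 * (1 - r ^+ k) ^+ 2)) => // k.
- exact: sqr_ge0.
- rewrite /truncate => ->.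
  rewrite /dilate_seq -{2}[c k]mulr1 -mulrBr normcM exprMn.
  by rewrite -rmorphXn -[1]/(1%:C) -rmorphB normc_real real_normK ?num_real //
    -(sqrrN (1 - _)) opprB.
rewrite /truncate ltnNge => -> /=; rewrite subr0 /dilate_seq normcM exprMn.
rewrite normc_exp normc_real ger0_norm // ler_piMr ?sqr_ge0 // expr_le1 ?exprn_ge0 //.
by rewrite exprn_ile1 // ltW.
Qed.

Lemma circle_sq_dilate_truncate f c n (r : R) : has_taylor f c -> l2 c -> 0 <= r < 1 ->
  (circle_sq (fun t => (dilate f r t - trigpoly n c t)%R) <=
    (2 * pi * (dilation_defect c n r + l2_tail c n))%:E)%E.
Proof.
move=> hf hc hr; have /andP[r0 r1] := hr.
have hlim t : D t -> ~ set0 t ->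
    ((fun m => trigpoly (m + n) (fun k => dilate_seq c r k - truncate n c k) t) : nat -> C^o)
      @ \oo --> (dilate f r t - trigpoly n c t : C^o).
  move=> _ _; have h1 := @trigpoly_dilate _ _ _ _ t hf r0 r1.
  have := cvgcB (@cvgc_sub _ (fun m => m + n)%N _ (fun j => leq_addr _ _) h1)
     (@cvgc_cst _ (trigpoly n c t)).
  by apply: cvgc_eq => m; rewrite -trigpolyB trigpoly_truncate // leq_addl.
apply: (circle_sq_lim (fun m => cmeas_trigpoly (m + n) _)
  (cmeasB (cmeas_dilate hf r0 r1) (cmeas_trigpoly n c)) measurable0 (measure0 mu) hlim).
move=> m; rewrite parseval_trigpoly lee_fin ler_wpM2l ?(ltW (pi2_gt0)) //.
exact: sum_dilate_truncate_le.
Qed.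

(** Let [F] be the almost everywhere limit of Taylor sections.  Fatou's lemma
bounds the square integral of the difference between [F] and the dilate by [r]
in terms of the coefficients [(1 - r^k) c_k]: finitely many of them tend to [0]
one by one, and the others contribute a small tail. *)
Lemma boundary_exists f c : has_taylor f c -> l2 c -> exists F, has_boundary f F.
Proof.
move=> hf hc; have [N [Z [F [jN mZ Z0 mF hF]]]] := ae_limit hc.
exists F; have [mF1 mF2] := mF; split => //.
  have : (circle_sq F <= (2 * pi * sqn c)%:E)%E.
    apply: (circle_sq_lim _ mF mZ Z0 hF) => [n|n]; first exact: cmeas_trigpoly.
    rewrite parseval_trigpoly lee_fin ler_wpM2l ?(ltW (pi2_gt0)) //.
    by have := series_le_sqn (N n) hc; rewrite /series /= big_mkord.
  by move=> h; apply: le_lt_trans h _; rewrite ltry.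
apply: cvge0P => [r|e e0]; first exact: circle_sq_ge0.
have [n hn] := cvgn_tail hc (divr_gt0 (divr_gt0 e0 (@pi2_gt0 R)) (ltr0n R 2)).
have hh : \forall r \near 1^'-, dilation_defect c n r < e / (2 * pi) / 2.
  have /cvgrPdist_lt := @dilation_defect_cvg c n.
  move=> /(_ _ (divr_gt0 (divr_gt0 e0 (@pi2_gt0 R)) (ltr0n R 2))).
  by apply: filterS => r; rewrite sub0r normrN; apply: le_lt_trans; exact: ler_norm.
apply: (filterS _ (filterI near_left1 hh)) => r [hr hhr]; have /andP[r0 r1] := hr.
apply: (@le_trans _ _ (2 * pi * (dilation_defect c n r + l2_tail c n))%:E).
  have hlim t : D t -> ~ Z t ->
      ((fun j => trigpoly (N j) (fun k => dilate_seq c r k - c k) t) : nat -> C^o)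
        @ \oo --> (dilate f r t - F t : C^o).
    move=> Dt nZ; have h1 := @trigpoly_dilate _ _ _ _ t hf r0 r1.
    have := cvgcB (cvgc_sub jN h1) (hF t Dt nZ).
    by apply: cvgc_eq => m; rewrite trigpolyB.
  apply: (circle_sq_lim (fun j => cmeas_trigpoly (N j) _)
    (cmeasB (cmeas_dilate hf r0 r1) mF) mZ Z0 hlim) => m.
  rewrite parseval_trigpoly lee_fin ler_wpM2l ?(ltW (pi2_gt0)) //.
  exact: sum_dilate_le.
rewrite lee_fin mulrC -ler_pdivlMr ?pi2_gt0 //.
by move: hn hhr; rewrite -/(l2_tail c n); lra.
Qed.

Lemma cmeas_boundary f F : has_boundary f F -> cmeas F.
Proof. by case. Qed.

Lemma has_boundary_near f F : has_boundary f F -> forall e : R, 0 < e ->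
  \forall r \near 1^'-, (circle_sq (fun t => (dilate f r t - F t)%R) <= e%:E)%E.
Proof.
case=> _ _ _ /fine_cvgP[hfin /cvgrPdist_lt h] e e0.
apply: (filterS _ (filterI hfin (h e e0))) => r [rfin].
rewrite /= sub0r normrN => hr; rewrite /circle_sq /dilate -(fineK rfin) lee_fin.
exact: le_trans (ler_norm _) (ltW hr).
Qed.

(** A boundary function is close to a dilate by definition, and a dilate with [r]
near [1] is close to a Taylor section. *)
Lemma boundary_approx f c F n (e : R) : has_taylor f c -> l2 c -> has_boundary f F ->
  0 < e -> (circle_sq (fun t => (F t - trigpoly n c t)%R) <= (4 * pi * l2_tail c n + e)%:E)%E.
Proof.
move=> hf hc hF e0; have mF := cmeas_boundary hF.
have pi0 := pi_gt0 R.
(* Two errors of size [x] occur, with weights [2] and [4 pi]. *)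
pose x : R := e / (2 + 4 * pi).
have x0 : 0 < x by rewrite divr_gt0 // addr_gt0 ?mulr_gt0.
have hh : \forall r \near 1^'-, dilation_defect c n r < x.
  have /cvgrPdist_lt/(_ _ x0) := @dilation_defect_cvg c n.
  by apply: filterS => r; rewrite sub0r normrN; apply: le_lt_trans; exact: ler_norm.
have [r [[hr hb] hhr]] :=
  filter_ex (filterI (filterI near_left1 (has_boundary_near hF x0)) hh).
have /andP[r0 r1] := hr; have mf := cmeas_dilate hf r0 r1.
rewrite (_ : (fun t => F t - _) =
  fun t => (F t - dilate f r t) + (dilate f r t - trigpoly n c t)); last first.
  by apply/funext => t; rewrite addrA subrK.
have mp := @cmeas_trigpoly R n c.
apply: (le_trans (circle_sqD (cmeasB mF mf) (cmeasB mf mp))).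
have -> : circle_sq (fun t => F t - dilate f r t) = circle_sq (fun t => dilate f r t - F t).
  by apply: eq_integral => t _; rewrite normc_subC.
have two0 : (0 <= 2%:E :> \bar R)%E by rewrite lee_fin.
apply: (le_trans (leeD (lee_wpmul2l two0 hb)
   (lee_wpmul2l two0 (circle_sq_dilate_truncate n hf hc hr)))).
rewrite -!EFinM -EFinD lee_fin.
have -> : e = x * (2 + 4 * pi) by rewrite /x divfK // gt_eqF // addr_gt0 ?mulr_gt0.
have : pi * dilation_defect c n r <= pi * x by rewrite ler_pM2l // ltW.
move=> hpx; have -> : 4 * pi * l2_tail c n + x * (2 + 4 * pi) =
  2 * x + 2 * (2 * (pi * x) + 2 * pi * l2_tail c n) by ring.
rewrite -subr_ge0 (_ : _ - _ = 4 * (pi * x - pi * dilation_defect c n r)); last by ring.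
by rewrite mulr_ge0 // subr_ge0.
Qed.

Lemma le_epsM (x y K : R) : 0 <= K -> (forall e, 0 < e -> x <= y + e * K) -> x <= y.
Proof.
move=> K0 h; apply/ler_addgt0Pr => e e0.
have K1 : 0 < K + 1 by lra.
have := h (e / (K + 1)) (divr_gt0 e0 K1) => /le_trans; apply.
by rewrite lerD2l mulrAC ler_pdivrMr // ler_pM2l //; lra.
Qed.

(** The constant in front of [|z|^2] can be brought near [1], as is needed to
compare norms and not only to bound them. *)
Lemma normcD_sqr_eps (e : R) (z w : C) : 0 < e ->
  normc (z + w) ^+ 2 <= (1 + e) * normc z ^+ 2 + (1 + e^-1) * normc w ^+ 2.
Proof.
move=> e0; apply: (@le_trans _ _ ((normc z + normc w) ^+ 2)).
  by rewrite ler_pXn2r ?nnegrE ?addr_ge0 ?normc_ge0 // le_normcD.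
move: (normc z) (normc w) => u v.
rewrite -subr_ge0 (_ : _ - _ = (e * u - v) ^+ 2 / e).
  by rewrite divr_ge0 ?sqr_ge0 // ltW.
by field; rewrite gt_eqF.
Qed.

(** Parseval's identity for an arbitrary boundary function: [F] and a Taylor
section are compared in both directions, with a factor [1 + e]. *)
Lemma boundary_norm f c F : has_taylor f c -> l2 c -> has_boundary f F ->
  circle_sq F = (2 * pi * sqn c)%:E.
Proof.
move=> hf hc hF; have mF := cmeas_boundary hF.
have Ffin : circle_sq F \is a fin_num.
  by rewrite ge0_fin_numE ?circle_sq_ge0 //; case: hF.
rewrite -(fineK Ffin); congr EFin; set x := fine _.
have x0 : 0 <= x by rewrite fine_ge0 // circle_sq_ge0.
set y := 2 * pi * sqn c.
have pi0 := pi_gt0 R.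
have y0 : 0 <= y by rewrite !mulr_ge0 ?sqn_ge0 // ltW.
have key (e : R) : 0 < e -> x <= (1 + e) * y + e /\ y <= (1 + e) * x + e + e.
  move=> e0; have ei0 : 0 < 1 + e^-1 by rewrite addr_gt0 ?invr_gt0.
  (* The error [q] is multiplied by [1 + 1/e] below; half of it pays for the tail. *)
  pose q := e / (1 + e^-1) / 2.
  have q0 : 0 < q by rewrite !divr_gt0.
  pose q' := Num.min (q / (4 * pi)) (e / (2 * pi)).
  have q'0 : 0 < q' by rewrite lt_min !divr_gt0 ?mulr_gt0.
  have [n] := cvgn_tail hc q'0.
  rewrite -/(l2_tail c n) lt_min => /andP[hn1' hn2'].
  have hn1 : l2_tail c n * (4 * pi) < q by rewrite -ltr_pdivlMr ?mulr_gt0.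
  have hn2 : l2_tail c n * (2 * pi) < e by rewrite -ltr_pdivlMr ?mulr_gt0.
  have hq := boundary_approx n hf hc hF q0.
  have mp := @cmeas_trigpoly R n c; have md := cmeasB mF mp.
  set S := \sum_(k < n) normc (c k) ^+ 2.
  have Sy : l2_tail c n = sqn c - S by rewrite /l2_tail /series /= big_mkord.
  have hS : S <= sqn c by rewrite -subr_ge0 -Sy l2_tail_ge0.
  have hqe : (1 + e^-1) * (4 * pi * l2_tail c n + q) <= e.
    rewrite mulrC -ler_pdivlMr // (_ : e / (1 + e^-1) = q + q); last by rewrite /q -splitr.
    by rewrite lerD2r mulrC ltW.
  have e1 : 0 <= 1 + e by rewrite addr_ge0 // ltW.
  have ex : (x%:E = circle_sq F)%E by rewrite fineK.
  have hp := parseval_trigpoly n c.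
  have ei0' : (0 <= (1 + e^-1)%:E)%E by rewrite lee_fin ltW.
  split; rewrite -lee_fin.
    rewrite ex; apply: (@le_trans _ _ ((1 + e)%:E * circle_sq (trigpoly n c) +
       (1 + e^-1)%:E * circle_sq (fun t => (F t - trigpoly n c t)%R))%E).
      apply: (circle_sq_le2 mF mp md e1 (ltW ei0)) => t.
      by rewrite -{1}(subrK (trigpoly n c t) (F t)) addrC normcD_sqr_eps.
    rewrite hp; apply: (le_trans (leeD (lexx _) (lee_wpmul2l ei0' hq))).
    rewrite -!EFinM -EFinD lee_fin lerD // ler_wpM2l // ler_wpM2l // mulr_ge0 //.
    exact: ltW.
  rewrite -[leLHS]/(y%:E) (_ : y = 2 * pi * S + l2_tail c n * (2 * pi)); last first.
    by rewrite Sy /y; ring.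
  rewrite EFinD [X in (_ <= X)%E]EFinD; apply: leeD; last by rewrite lee_fin ltW.
  rewrite -hp; apply: (@le_trans _ _ ((1 + e)%:E * circle_sq F +
       (1 + e^-1)%:E * circle_sq (fun t => (F t - trigpoly n c t)%R))%E).
    apply: (circle_sq_le2 mp mF md e1 (ltW ei0)) => t.
    have := normcD_sqr_eps (F t) (trigpoly n c t - F t) e0.
    by rewrite [F t + _]addrC subrK normc_subC.
  apply: (le_trans (leeD (lexx _) (lee_wpmul2l ei0' hq))).
  by rewrite -ex -!EFinM -EFinD lee_fin lerD2l.
apply/eqP; rewrite eq_le; apply/andP; split.
  apply: (@le_epsM _ _ (y + 1)) => [|e /key[h _]]; first by rewrite addr_ge0.
  by apply: le_trans h _; rewrite mulrDr mulr1 mulrDl mul1r addrA.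
apply: (@le_epsM _ _ (x + 2)) => [|e /key[_ h]]; first by rewrite addr_ge0.
by apply: le_trans h _; lra.
Qed.

Lemma has_boundary_comb f g c d F G (x : C) : has_taylor f c -> has_taylor g d ->
  has_boundary f F -> has_boundary g G ->
  has_boundary (fun z => f z + x * g z) (fun t => F t + x * G t).
Proof.
move=> hf hg hF hG; have mF := cmeas_boundary hF; have mG := cmeas_boundary hG.
have mFG := cmeasD mF (@cmeasZ _ x _ mG); have [m1 m2] := mFG.
have x0 : 0 <= 2 * normc x ^+ 2 by rewrite mulr_ge0 // sqr_ge0.
have comb (F1 G1 : R -> C) : cmeas F1 -> cmeas G1 ->
    (circle_sq (fun t => (F1 t + x * G1 t)%R) <=
     2%:E * circle_sq F1 + (2 * normc x ^+ 2)%:E * circle_sq G1)%E.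
  move=> h1 h2.
  apply: (circle_sq_le2 (cmeasD h1 (@cmeasZ _ x _ h2)) h1 h2 (ler0n R 2) x0) => t.
  apply: le_trans (normcD_sqr _ _) _.
  by rewrite normcM exprMn lerD2l mulrA; exact: lexx.
have x0' : (0 <= (2 * normc x ^+ 2)%:E)%E by rewrite lee_fin.
have two0 : (0 <= 2%:E :> \bar R)%E by rewrite lee_fin.
split => //.
  apply: le_lt_trans (comb _ _ mF mG) _.
  have Ffin : (circle_sq F < +oo)%E by case: hF.
  have Gfin : (circle_sq G < +oo)%E by case: hG.
  by rewrite lte_add_pinfty // lte_mul_pinfty // ?circle_sq_ge0.
apply: cvge0P => [r|e e0]; first exact: circle_sq_ge0.
set K := 2 + 2 * normc x ^+ 2.
have K0 : 0 < K by rewrite /K; lra.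
have eK : 0 < e / K by rewrite divr_gt0.
near=> r.
have /andP[r0 r1] : 0 <= r < 1 by near: r; exact: near_left1.
have h1 : (circle_sq (fun t => (dilate f r t - F t)%R) <= (e / K)%:E)%E.
  by near: r; exact: has_boundary_near.
have h2 : (circle_sq (fun t => (dilate g r t - G t)%R) <= (e / K)%:E)%E.
  by near: r; exact: has_boundary_near.
rewrite (_ : integral _ _ _ = circle_sq (fun t => (dilate f r t - F t) + x * (dilate g r t - G t))).
  have mf := cmeasB (cmeas_dilate hf r0 r1) mF.
  have mg := cmeasB (cmeas_dilate hg r0 r1) mG.
  apply: (le_trans (comb _ _ mf mg)).
  apply: (le_trans (leeD (lee_wpmul2l two0 h1) (lee_wpmul2l x0' h2))).
  rewrite -!EFinM -EFinD lee_fin -mulrDl -/K mulrC divfK ?gt_eqF //.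
apply: eq_integral => t _; congr ((normc _) ^+ 2)%:E.
by rewrite /dilate; ring.
Unshelve. all: by end_near. Qed.

Lemma sqn_comb c d (x : C) : l2 c -> l2 d ->
  sqn (fun k => c k + x * d k) =
  sqn c + normc x ^+ 2 * sqn d + 2 * complex.Re (x^* * dot c d).
Proof.
move=> hc hd; have hxd := @l2Z _ x _ hd.
rewrite sqnE; last exact: l2D.
rewrite dotDl ?dotDr ?dotZl ?dotZr //; try exact: l2D.
rewrite [dot d c]dotC // !dotcc //.
case: (dot c d) x {hxd} => u v [p q]; rewrite normc2E; simpc => /=.
by rewrite !expr2; ring.
Qed.

(** Polarization: [4 Re (F conj G) = |F + G|^2 - |F - G|^2], where [F + G] and
[F - G] are boundary functions of [f + g] and [f - g]. *)
Lemma Rintegral_cross f g c d F G : has_taylor f c -> has_taylor g d ->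
  l2 c -> l2 d -> has_boundary f F -> has_boundary g G ->
  (\int[mu]_(t in D) complex.Re (F t * (G t)^*))%R = 2 * pi * complex.Re (dot c d).
Proof.
move=> hf hg hc hd hF hG.
have N (x : C) : circle_sq (fun t => F t + x * G t) = (2 * pi * sqn (fun k => c k + x * d k))%:E.
  apply: boundary_norm (has_boundary_comb x hf hg hF hG).
    exact: has_taylorD (@has_taylorZ _ x _ _ hg).
  by apply: l2D => //; exact: l2Z.
have I (x : C) : mu.-integrable D (EFin \o (fun t => normc (F t + x * G t) ^+ 2)).
  have mFG := cmeasD (cmeas_boundary hF) (@cmeasZ _ x _ (cmeas_boundary hG)).
  apply/integrableP; split; first exact: emeas_normc2.
  rewrite (_ : integral _ _ _ = circle_sq (fun t => F t + x * G t)).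
    by rewrite N ltry.
  by apply: eq_integral => t _ /=; rewrite ger0_norm // sqr_ge0.
have mD := @measurable_circle R.
rewrite (_ : (fun t => complex.Re _) = fun t =>
   (4^-1 * (normc (F t + 1 * G t) ^+ 2 - normc (F t + (-1) * G t) ^+ 2))%R); last first.
  apply/funext => t; rewrite !normc2E; case: (F t) (G t) => u v [p q]; simpc => /=.
  by field.
rewrite RintegralZl //; last first.
  by apply: (@integrableB _ _ _ mu D mD _ _ (I 1) (I (-1))).
rewrite (@RintegralB _ _ _ mu D _ _ mD (I 1) (I (-1))).
rewrite /Rintegral -![integral _ _ _]/(circle_sq _) !N /= !sqn_comb //.
by rewrite normcN normc1 /=; case: (dot c d) => u v; simpc => /=; field.
Qed.

Lemma boundaryP f c : has_taylor f c -> l2 c -> has_boundary f (boundary f).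
Proof.
move=> hf hc; have [F hF] := boundary_exists hf hc.
exact: (@xgetPex _ (fun=> 0) [set F | has_boundary f F] (ex_intro _ F hF)).
Qed.

(** The imaginary part is the real part with [i g] in place of [g]. *)
Theorem ipE f g c d : has_taylor f c -> has_taylor g d -> l2 c -> l2 d ->
  ip f g = dot c d.
Proof.
move=> hf hg hc hd; have hF := boundaryP hf hc; have hG := boundaryP hg hd.
have hRe := Rintegral_cross hf hg hc hd hF hG.
have hid := @l2Z _ ('i%C : C) _ hd.
have hg' := @has_taylorZ _ ('i%C : C) _ _ hg.
have hG' : has_boundary (fun z => 'i%C * g z) (fun t => 'i%C * boundary g t).
  (* [i g] is [g + (i - 1) g]. *)
  have := has_boundary_comb ('i%C - 1 : C) hg hg hG hG.
  rewrite (_ : (fun z => _) = fun z => 'i%C * g z); last by apply/funext => z; ring.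
  by rewrite (_ : (fun t => _) = fun t => 'i%C * boundary g t) //; apply/funext => t; ring.
have hIm := Rintegral_cross hf hg' hc hid hF hG'.
rewrite /ip /circle_int.
rewrite (_ : (fun t => complex.Im (boundary f t * (boundary g t)^*)) =
  fun t => complex.Re (boundary f t * ('i%C * boundary g t)^*)); last first.
  by apply/funext => t; case: (boundary f t) (boundary g t) => u v [p q]; simpc.
rewrite hRe hIm dotZr //; have := @pi2_gt0 R; case: (dot c d) => u v h.
by simpc; congr (_ +i* _); rewrite /= mulKf // gt_eqF.
Qed.

Lemma taylorE f c : has_taylor f c -> taylor f = c.
Proof.
move=> hf; apply: (has_taylor_unique _ hf).
exact: (@xgetPex _ (fun=> 0) [set c | has_taylor f c] (ex_intro _ c hf)).
Qed.

Lemma normsqE f c : has_taylor f c -> l2 c -> normsq f = (sqn c)%:E.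
Proof.
move=> hf hc; rewrite /normsq (taylorE hf); apply: cvg_lim => //.
apply: cvg_EFin; first by apply: nearW => n; rewrite sumEFin.
rewrite (_ : _ \o _ = series (fun k => normc (c k) ^+ 2)); first exact: hc.
by apply/funext => n /=; rewrite sumEFin.
Qed.

Lemma h2normE f c : has_taylor f c -> l2 c -> h2norm f = Num.sqrt (sqn c).
Proof. by move=> hf hc; rewrite /h2norm (normsqE hf hc). Qed.

Lemma l2_H2 f : H2 f -> l2 (taylor f).
Proof.
case=> _ hf; apply: (@l2_bounded _ _ (fine (normsq f))) => n.
have f0 k : (0 <= (normc (taylor f k) ^+ 2)%:E)%E by rewrite lee_fin sqr_ge0.
have nfin : normsq f \is a fin_num by rewrite ge0_fin_numE // nneseries_ge0.
rewrite -lee_fin fineK // /series /= -sumEFin.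
exact: (@nneseries_lim_ge _ (fun k => (normc (taylor f k) ^+ 2)%:E) xpredT 0 n (fun k _ _ => f0 k)).
Qed.

End Boundary.

(** * Multiplication by Moebius factors *)

Section Moebius.
Context {R : realType}.
Local Notation C := R[i].
Implicit Types (c d h : nat -> C) (f g : C -> C) (a b z : C).

Lemma conjCR (x : R) : Num.conj (x%:C : C) = x%:C.
Proof. exact: conjc_real. Qed.

Lemma normc_lt1_sqr a : disc a -> normc a ^+ 2 < 1.
Proof. by move=> /discP a1; rewrite expr_lt1 // normc_ge0. Qed.

Lemma disc_denom a z : disc a -> disc z -> 1 - a^* * z != 0.
Proof.
move=> /discP a1 /discP z1; rewrite subr_eq0; apply/eqP => h.
have : normc (a^* * z) < 1.
  rewrite normcM normc_conj (@le_lt_trans _ _ (normc a)) // ler_piMr ?normc_ge0 //.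
  exact: ltW.
by rewrite -h [normc _]normc1 ltxx.
Qed.

(** The coefficients of [f z / (1 - conj a z)], those of [f] being [h]. *)
Fixpoint div_denom a h k : C := if k is k'.+1 then h k'.+1 + a^* * div_denom a h k' else h 0%N.

Lemma div_denomE a h k : div_denom a h k = h k + a^* * ushift (div_denom a h) k.
Proof. by case: k => [|k] //=; rewrite mulr0 addr0. Qed.

Lemma l2_div_denom a h : l2 h -> disc a -> l2 (div_denom a h).
Proof.
move=> hh /discP a1; set s := normc a in a1.
have s0 : 0 <= s by exact: normc_ge0.
have s1 : 0 < 1 - s by rewrite subr_gt0.
apply: (@l2_bounded _ _ ((sqn h / (1 - s)) / (1 - s))) => n.
rewrite ler_pdivlMr //; set V := series _ n.
suff : V <= sqn h / (1 - s) + s * V by lra.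
apply: (@le_trans _ _ (series (fun k => normc (h k) ^+ 2 / (1 - s)
    + s * normc (ushift (div_denom a h) k) ^+ 2) n)).
  apply: ler_sum => k _; rewrite div_denomE.
  apply: le_trans (normc_convex _ _ s0 a1).
  rewrite lerXn2r ?nnegrE ?addr_ge0 ?mulr_ge0 ?normc_ge0 //.
  by rewrite /s -(normc_conj a) -normcM le_normcD.
rewrite /series /= big_split /= -mulr_suml -mulr_sumr lerD //.
  by rewrite ler_wpM2r ?invr_ge0 ?(ltW s1) // series_le_sqn.
rewrite ler_wpM2l // /V /series /=; case: n {V} => [|n]; first by rewrite !big_nil.
rewrite big_nat_recl // [leRHS]big_nat_recr //=.
by rewrite !expr0n addr0 sqrtr0 expr0n add0r lerDl sqr_ge0.
Qed.

Lemma has_taylor_div_denom f a h : has_taylor f h -> l2 h -> disc a ->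
  has_taylor (fun z => f z / (1 - a^* * z)) (div_denom a h).
Proof.
move=> hf hh ha; have hg := l2_div_denom hh ha.
apply: eq_has_taylor (evP hg) => z hz.
have := has_taylorD hf (@has_taylorZ _ a^* _ _ (has_taylor_ushift (evP hg))).
rewrite (_ : (fun k => h k + _) = div_denom a h); last by apply/funext => k; rewrite -div_denomE.
move=> /evE/(_ hz) => hE; have hn := disc_denom ha hz.
apply: (mulIf hn); rewrite divfK // mulrBr mulr1 {1}hE.
by ring.
Qed.

(** The coefficients of [moebius a z * f z], those of [f] being [h]. *)
Definition mmul a h : nat -> C := fun k => ushift (div_denom a h) k - a * div_denom a h k.

Lemma l2_mmul a h : l2 h -> disc a -> l2 (mmul a h).
Proof.
move=> hh ha; have hg := l2_div_denom hh ha.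
by apply: l2B; [exact: l2_ushift|exact: l2Z].
Qed.

Lemma has_taylor_mmul f a h : has_taylor f h -> l2 h -> disc a ->
  has_taylor (fun z => moebius a z * f z) (mmul a h).
Proof.
move=> hf hh ha; have hg := has_taylor_div_denom hf hh ha.
apply: eq_has_taylor (has_taylorB (has_taylor_ushift hg) (@has_taylorZ _ a _ _ hg)) => z hz.
by rewrite /moebius; ring.
Qed.

Lemma dot_sub2 (x y : C) c c' d d' : l2 c -> l2 c' -> l2 d -> l2 d' ->
  dot (fun k => c k - x * c' k) (fun k => d k - y * d' k) =
  dot c d - y^* * dot c d' - x * dot c' d + x * y^* * dot c' d'.
Proof.
move=> hc hc' hd hd'; have hx := @l2Z _ x _ hc'; have hy := @l2Z _ y _ hd'.
have he := l2B hd hy.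
rewrite (dotBl hc hx he) (dotZl x hc' he) (dotBr hd hy hc) (dotBr hd hy hc').
by rewrite (dotZr y hd' hc) (dotZr y hd' hc'); ring.
Qed.

(** Let [u] and [v] be the quotients of [c] and [d] by [1 - conj a z].  The left
side pairs [(z - a) u] with [(z - a) v], the right side [(1 - conj a z) u] with
[(1 - conj a z) v]; both expand to the same terms because multiplication by [z]
is an isometry. *)
Lemma dot_mmul a c d : l2 c -> l2 d -> disc a -> dot (mmul a c) (mmul a d) = dot c d.
Proof.
move=> hc hd ha; have hu := l2_div_denom hc ha; have hv := l2_div_denom hd ha.
have E h : h = fun k => div_denom a h k - a^* * ushift (div_denom a h) k.
  by apply/funext => k; rewrite {1}div_denomE addrK.
have su := l2_ushift hu; have sv := l2_ushift hv.
rewrite [in RHS](E c) [in RHS](E d) /mmul.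
rewrite (dot_sub2 _ _ su hu sv hv) (dot_sub2 _ _ hu su hv sv) !dot_ushift // conjCK.
by ring.
Qed.

Definition powseq a : nat -> C := fun k => a^* ^+ k.

Lemma l2_powseq a : disc a -> l2 (powseq a).
Proof.
move=> ha; apply: (@l2_le _ _ (geometric 1 (normc a ^+ 2))) => [k|].
  by rewrite normc_exp normc_conj /geometric /= mul1r exprAC.
by apply: is_cvg_geometric_series; rewrite ger0_norm ?sqr_ge0 // normc_lt1_sqr.
Qed.

Lemma ev_powseq a z : disc a -> disc z -> ev (powseq a) z = (1 - a^* * z)^-1.
Proof.
move=> ha hz; have hp := l2_powseq ha.
have := has_taylor_behead hp (evP hp) hz.
have -> : behead_seq (powseq a) = fun k => a^* * powseq a k.
  by apply/funext => k; rewrite /behead_seq /powseq exprS.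
rewrite (evE (@has_taylorZ _ a^* _ _ (evP hp)) hz) {2}/powseq expr0 => h.
have hn := disc_denom ha hz; apply: (mulIf hn); rewrite mulVf // mulrBr mulr1 {1}h.
by ring.
Qed.

Definition szegoseq a : nat -> C := fun k => (Num.sqrt (1 - normc a ^+ 2))%:C * powseq a k.

Lemma l2_szego a : disc a -> l2 (szegoseq a).
Proof. by move=> ha; apply: l2Z; exact: l2_powseq. Qed.

Lemma has_taylor_szego a : disc a -> has_taylor (szego a) (szegoseq a).
Proof.
move=> ha; have := @has_taylorZ _ (Num.sqrt (1 - normc a ^+ 2))%:C _ _ (evP (l2_powseq ha)).
by apply: eq_has_taylor => z hz; rewrite ev_powseq.
Qed.

Lemma dot_szego c a : l2 c -> disc a ->
  dot c (szegoseq a) = (Num.sqrt (1 - normc a ^+ 2))%:C * ev c a.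
Proof.
move=> hc ha; have hp := l2_powseq ha.
rewrite dotZr // conjCR; congr (_ * _); apply/esym/csum_eq.
apply: cvgc_eq (dotP hc hp) => n; rewrite /series /=; apply: eq_bigr => k _.
by rewrite /powseq rmorphXn /= conjCK.
Qed.

Lemma szego_diag a : disc a ->
  (Num.sqrt (1 - normc a ^+ 2))%:C * szego a a = 1.
Proof.
move=> ha; have h1 := normc_lt1_sqr ha.
rewrite /szego mulrA -rmorphM /= -expr2 sqr_sqrtr ?subr_ge0 ?(ltW h1) //.
have -> : 1 - a^* * a = (1 - normc a ^+ 2)%:C by rewrite mulrC mulcJ rmorphB.
by rewrite mulfV // fmorph_eq0 subr_eq0 gt_eqF.
Qed.

Lemma dot_szego_self a : disc a -> dot (szegoseq a) (szegoseq a) = 1.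
Proof.
move=> ha; rewrite dot_szego ?(evE (has_taylor_szego ha)) ?szego_diag //.
exact: l2_szego.
Qed.

(** [|1 - conj a z|^2 - |z - a|^2 = (1 - |a|^2) (1 - |z|^2)]. *)
Lemma normc_moebius_le1 a z : disc a -> disc z -> normc (moebius a z) <= 1.
Proof.
move=> ha hz; have hn := disc_denom ha hz.
have n0 : 0 < normc (1 - a^* * z).
  by rewrite lt_neqAle normc_ge0 andbT eq_sym; apply: contraNneq hn => /eq0_normc ->.
rewrite /moebius normcM normcV ler_pdivrMr // mul1r.
rewrite -(@ler_pXn2r _ 2%N) ?nnegrE ?normc_ge0 // -subr_ge0.
have -> : normc (1 - a^* * z) ^+ 2 - normc (z - a) ^+ 2 =
    (1 - normc a ^+ 2) * (1 - normc z ^+ 2).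
  rewrite !normc2E; case: a z {ha hz hn n0} => [u v] [p q]; simpc => /=.
  by rewrite !expr2; ring.
by rewrite mulr_ge0 // subr_ge0 ltW // normc_lt1_sqr.
Qed.

End Moebius.

(** * Deflation *)

Section Deflation.
Context {R : realType}.
Local Notation C := R[i].
Implicit Types (c d h : nat -> C) (f g : C -> C) (b z : C).

Lemma ip_szego f c a : has_taylor f c -> l2 c -> disc a ->
  ip f (szego a) = (Num.sqrt (1 - normc a ^+ 2))%:C * f a.
Proof.
move=> hf hc ha.
by rewrite (ipE hf (has_taylor_szego ha) hc (l2_szego ha)) dot_szego // (evE hf ha).
Qed.

Lemma l2_mul_denom c a : l2 c -> l2 (fun k => c k - a^* * ushift c k).
Proof. by move=> hc; apply: l2B => //; apply: l2Z; exact: l2_ushift. Qed.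

Lemma has_taylor_mul_denom f c a : has_taylor f c ->
  has_taylor (fun z => (1 - a^* * z) * f z) (fun k => c k - a^* * ushift c k).
Proof.
move=> hf; apply: eq_has_taylor (has_taylorB hf (@has_taylorZ _ a^* _ _ (has_taylor_ushift hf))).
by move=> z _; ring.
Qed.

(** Subtracting the projection on the kernel makes the numerator vanish at [a],
so it is [(z - a) V z].  If [V a] were not [0], the quotient by the squared
Moebius factor would blow up at [a]; continuity of [g] excludes this, so
[V z = (z - a) W z] and [g z = (1 - conj a z)^2 W z]. *)
Lemma deflationP f c a g : has_taylor f c -> l2 c -> disc a -> deflation f a g ->
  exists d, [/\ has_taylor g d, l2 d & forall z, disc z ->
    f z = ip f (szego a) * szego a z + moebius a z ^+ 2 * g z].
Proof.
move=> hf hc ha [hg cg]; set x := ip f (szego a) in hg *.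
have hs := has_taylor_szego ha; have ls := l2_szego ha.
have hh := has_taylorB hf (@has_taylorZ _ x _ _ hs).
have lh := l2B hc (@l2Z _ x _ ls).
set c' := (fun k => c k - x * szegoseq a k) in hh lh.
set h := (fun z => f z - x * szego a z) in hh.
have ha0 : h a = 0.
  by rewrite /h /x (ip_szego hf hc ha) -mulrA [f a * _]mulrC mulrA szego_diag // mul1r subrr.
pose v := diff_quo c' a; have lv : l2 v by exact: l2_diff_quo.
have hV z : disc z -> h z = (z - a) * ev v z.
  by move=> hz; rewrite (diff_quoP lh hh ha hz) ha0 add0r.
have hgz z : disc z -> z != a -> g z * (z - a) ^+ 2 = h z * (1 - a^* * z) ^+ 2.
  move=> hz za; have hn := disc_denom ha hz; rewrite hg // -/(h z) /moebius.
  have za' : z - a != 0 by rewrite subr_eq0.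
  by rewrite expr_div_n; field; rewrite za' hn.
pose v20 k := v k - a^* * ushift v k.
pose v2 k := v20 k - a^* * ushift v20 k.
have hv2 : has_taylor _ v2 := @has_taylor_mul_denom _ _ a (@has_taylor_mul_denom _ _ a (evP lv)).
have lv2 : l2 v2 := @l2_mul_denom _ a (@l2_mul_denom _ a lv).
have va : ev v a = 0.
  have : ev v2 a = g a * (a - a).
    apply: (@punctured_eq _ (ev v2) (fun z => g z * (z - a)) a ha).
    - exact: ev_continuous.
    - apply: (@cvgM C C^o (nbhs (a : C^o)) _ g (fun z => z - a) (g a) (a - a) cg).
      exact: (@cvgB C C^o C^o (nbhs (a : C^o)) _ id
        (fun=> a) a a (@cvg_id _ (nbhs (a : C^o))) (cvg_cst _)).
    move=> z hz za; have za' : z - a != 0 by rewrite subr_eq0.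
    by apply: (mulIf za'); rewrite (evE hv2 hz) -[RHS]mulrA -[(z - a) * (z - a)]expr2 hgz // hV //; ring.
  rewrite subrr mulr0 (evE hv2 ha) => /eqP.
  by rewrite !mulf_eq0 !(negbTE (disc_denom ha ha)) /= => /eqP.
pose w := diff_quo v a; have lw : l2 w by exact: l2_diff_quo.
have hW z : disc z -> ev v z = (z - a) * ev w z.
  by move=> hz; rewrite (diff_quoP lv (evP lv) ha hz) va add0r.
pose w20 k := w k - a^* * ushift w k.
pose w2 k := w20 k - a^* * ushift w20 k.
have hw2 : has_taylor _ w2 := @has_taylor_mul_denom _ _ a (@has_taylor_mul_denom _ _ a (evP lw)).
have lw2 : l2 w2 := @l2_mul_denom _ a (@l2_mul_denom _ a lw).
have gw z : disc z -> z != a -> ev w2 z = g z.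
  move=> hz za; have za' : (z - a) ^+ 2 != 0 by rewrite expf_eq0 /= subr_eq0.
  by apply: (mulIf za'); rewrite hgz // (evE hw2 hz) hV // hW //; ring.
have gw' z : disc z -> ev w2 z = g z.
  move=> hz; have [->|/(gw z hz)//] := eqVneq z a.
  by apply: (punctured_eq ha _ cg gw); exact: ev_continuous.
exists w2; split; [exact: (eq_has_taylor gw' (evP lw2))|exact: lw2|].
move=> z hz; have hn := disc_denom ha hz.
rewrite -gw' // (evE hw2 hz); apply/eqP; rewrite addrC -subr_eq -/(h z); apply/eqP.
by rewrite hV // hW // /moebius; field.
Qed.

End Deflation.

(** * Squared Blaschke products *)

Section Blaschke.
Context {R : realType}.
Local Notation C := R[i].
Context (a : nat -> C) (ha : forall k, (1 <= k)%N -> disc (a k)).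
Implicit Types (c d h : nat -> C) (f g : C -> C) (b z : C).

Definition blaschke2 n z : C := \prod_(1 <= l < n.+1) moebius (a l) z ^+ 2.

(** Multiplication by [blaschke2 a n] on coefficient sequences.  The factor of
highest index acts first, so that an initial product can be split off on the
outside. *)
Fixpoint bmul n h : nat -> C :=
  if n is m.+1 then bmul m (mmul (a m.+1) (mmul (a m.+1) h)) else h.

Lemma l2_mmul2 n h : l2 h -> l2 (mmul (a n.+1) (mmul (a n.+1) h)).
Proof. by move=> hh; apply: l2_mmul; [exact: l2_mmul (ha _)|exact: ha]. Qed.
#[global] Arguments l2_mmul2 n [h] hh : rename.


Lemma l2_bmul n h : l2 h -> l2 (bmul n h).
Proof. by elim: n h => //= n IH h hh; apply: IH; exact: l2_mmul2. Qed.
#[global] Arguments l2_bmul n [h] hh : rename.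


Lemma dot_bmul n c d : l2 c -> l2 d -> dot (bmul n c) (bmul n d) = dot c d.
Proof.
elim: n c d => //= n IH c d hc hd; have hn := ha (ltn0Sn n).
rewrite (IH _ _ (l2_mmul2 n hc) (l2_mmul2 n hd)).
by rewrite (dot_mmul (l2_mmul hc hn) (l2_mmul hd hn) hn) (dot_mmul hc hd hn).
Qed.

Lemma has_taylor_mmul2 n f h : has_taylor f h -> l2 h ->
  has_taylor (fun z => moebius (a n.+1) z ^+ 2 * f z) (mmul (a n.+1) (mmul (a n.+1) h)).
Proof.
move=> hf hh; have hn := ha (ltn0Sn n).
apply: eq_has_taylor (has_taylor_mmul (has_taylor_mmul hf hh hn) (l2_mmul hh hn) hn).
by move=> z _; rewrite expr2 mulrA.
Qed.
#[global] Arguments has_taylor_mmul2 n [f h] hf hh : rename.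


Lemma has_taylor_bmul n f h : has_taylor f h -> l2 h ->
  has_taylor (fun z => blaschke2 n z * f z) (bmul n h).
Proof.
elim: n f h => [|n IH] f h hf hh.
  by apply: eq_has_taylor hf => z _; rewrite /blaschke2 big_geq // mul1r.
apply: eq_has_taylor (IH _ _ (has_taylor_mmul2 n hf hh) (l2_mmul2 n hh)) => z _.
by rewrite /blaschke2 [in RHS]big_nat_recr //= mulrA.
Qed.
#[global] Arguments has_taylor_bmul n [f h] hf hh : rename.


Lemma normc_blaschke2_le1 n z : disc z -> normc (blaschke2 n z) <= 1.
Proof.
move=> hz; rewrite /blaschke2; elim: n => [|n IH].
  by rewrite big_geq // [normc _]normc1.
rewrite big_nat_recr //= normcM mulr_ile1 ?normc_ge0 // normc_exp exprn_ile1 ?normc_ge0 //.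
by apply: normc_moebius_le1; [exact: ha|].
Qed.

Lemma bmul_factor n j h : (j < n)%N -> l2 h -> exists2 h', l2 h' &
  bmul n h = bmul j (mmul (a j.+1) (mmul (a j.+1) h')).
Proof.
elim: n h => // n IH h; rewrite ltnS leq_eqVlt => /orP[/eqP -> hh|jn hh].
  by exists h.
by have [h' lh' E] := IH _ jn (l2_mmul2 n hh); exists h'.
Qed.

(** A function that vanishes at a point is orthogonal to the kernel there. *)
Lemma mmul2_orth n h : l2 h -> dot (mmul (a n.+1) (mmul (a n.+1) h)) (szegoseq (a n.+1)) = 0.
Proof.
move=> hh; have hn := ha (ltn0Sn n); rewrite dot_szego //; last exact: l2_mmul2.
rewrite (evE (has_taylor_mmul2 n (evP hh) hh) hn).
by rewrite /moebius subrr mul0r expr0n mul0r mulr0.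
Qed.

Lemma bmul_orth n j h : (j < n)%N -> l2 h -> dot (bmul n h) (bmul j (szegoseq (a j.+1))) = 0.
Proof.
move=> jn hh; have [h' lh' ->] := bmul_factor jn hh.
rewrite (dot_bmul j (l2_mmul2 j lh') (l2_szego (ha (ltn0Sn j)))).
exact: mmul2_orth.
Qed.

Lemma has_taylor_TM n : has_taylor (double_TM a n.+1) (bmul n (szegoseq (a n.+1))).
Proof.
have hn := ha (ltn0Sn n).
apply: eq_has_taylor (has_taylor_bmul n (has_taylor_szego hn) (l2_szego hn)) => z _.
by rewrite /double_TM /blaschke2 mulrC.
Qed.


End Blaschke.

(** * The greedy expansion *)

Section Greedy.
Context {R : realType}.
Local Notation C := R[i].
Context (f : C -> C) (cf : nat -> C) (ft : nat -> C -> C) (a : nat -> C).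
Context (hf : has_taylor f cf) (lf : l2 cf).
Context (hft1 : forall z, disc z -> ft 1%N z = f z).
Context (hmax : forall k, (1 <= k)%N -> maximizes (ft k) (a k)).
Context (hft : forall k, (1 <= k)%N -> deflation (ft k) (a k) (ft k.+1)).

Let T n := taylor (ft n.+1).
Let x n := ip (ft n.+1) (szego (a n.+1)).
Let r n := sqn (T n).

Lemma disc_max k : (1 <= k)%N -> disc (a k).
Proof. by move=> /hmax[]. Qed.

Lemma taylor_iterate n : has_taylor (ft n.+1) (T n) /\ l2 (T n).
Proof.
elim: n => [|n [hT lT]].
  have h1 : has_taylor (ft 1) cf.
    by apply: (eq_has_taylor _ hf) => z hz; rewrite hft1.
  by rewrite /T (taylorE h1).
have hn := disc_max (ltn0Sn n).
have [d [hd ld _]] := deflationP hT lT hn (hft (ltn0Sn n)).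
by rewrite /T (taylorE hd).
Qed.

Lemma xE n : x n = dot (T n) (szegoseq (a n.+1)).
Proof.
have [hT lT] := taylor_iterate n; have hn := disc_max (ltn0Sn n).
exact: (ipE hT (has_taylor_szego hn) lT (l2_szego hn)).
Qed.

Lemma deflation_step n z : disc z ->
  ft n.+1 z = x n * szego (a n.+1) z + moebius (a n.+1) z ^+ 2 * ft n.+2 z.
Proof.
have [hT lT] := taylor_iterate n; have hn := disc_max (ltn0Sn n).
by have [d [_ _ h]] := deflationP hT lT hn (hft (ltn0Sn n)) => /h.
Qed.

Lemma greedy_expansion n z : disc z ->
  f z = \sum_(j < n) x j * double_TM a j.+1 z + blaschke2 a n z * ft n.+1 z.
Proof.
move=> hz; elim: n => [|n IH].
  by rewrite big_ord0 add0r /blaschke2 big_geq // mul1r hft1.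
rewrite IH deflation_step // big_ord_recr /= /double_TM /blaschke2.
rewrite [\prod_(1 <= l < n.+2) _]big_nat_recr //=. rewrite -[RHS]addrA; congr (_ + _).
by ring.
Qed.

Let B n := bmul a n.
Let lB n h : l2 h -> l2 (B n h) := l2_bmul disc_max n (h := h).
Let s n := szegoseq (a n.+1).

Lemma l2_s n : l2 (s n).
Proof. exact: l2_szego (disc_max (ltn0Sn n)). Qed.

Lemma cf_expansion n : cf = fun k => \sum_(j < n) x j * B j (s j) k + B n (T n) k.
Proof.
apply: (has_taylor_unique hf).
have [hT lT] := taylor_iterate n.
have hS := @has_taylor_sum _ _ (index_enum 'I_n)
  (fun j z => x j * double_TM a j.+1 z) (fun j k => x j * B j (s j) k)
  (fun j => @has_taylorZ _ (x j) _ _ (@has_taylor_TM _ _ disc_max j)).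
apply: (eq_has_taylor _ (has_taylorD hS (has_taylor_bmul disc_max n hT lT))) => z hz.
by rewrite -greedy_expansion.
Qed.

Lemma l2_term (j : nat) : l2 (fun k => x j * B j (s j) k).
Proof. by apply: l2Z; apply: lB; exact: l2_s. Qed.

(** In the expansion of [f] the terms of index other than [n] are orthogonal to
the [n]-th one, and multiplication by the Blaschke product is an isometry. *)
Lemma ip_TM n : ip f (double_TM a n.+1) = x n.
Proof.
have [hT lT] := taylor_iterate n; have lt := @lB n _ lT.
have ls := @lB n _ (@l2_s n).
rewrite (ipE hf (@has_taylor_TM _ _ disc_max n) lf ls) [X in dot X _](cf_expansion n).
have lsum : l2 (fun k => \sum_(j < n) x j * B j (s j) k).
  by apply: l2_sum => j; exact: l2_term.
rewrite (dotDl lsum lt ls) (dot_bmul disc_max n lT (@l2_s n)) -xE.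
rewrite (@dot_suml _ _ _ (fun (j : 'I_n) k => x j * B j (s j) k)) //; last by move=> j;
  exact: l2_term.
rewrite big1 ?add0r // => j _; have lj := @lB j _ (@l2_s j).
rewrite dotZl // (dotC ls lj) (bmul_orth disc_max (ltn_ord j) (@l2_s n)).
by rewrite rmorph0 mulr0.
Qed.

Lemma remainderE n z : disc z -> remainder f a n.+1 z = blaschke2 a n z * ft n.+1 z.
Proof.
move=> hz; rewrite /remainder {1}(greedy_expansion n hz) big_add1 /= big_mkord.
under [X in _ - X]eq_bigr do rewrite ip_TM.
by rewrite addrC addKr.
Qed.

Lemma h2norm_remainder n : h2norm (remainder f a n.+1) = Num.sqrt (r n).
Proof.
have [hT lT] := taylor_iterate n; have lt := @lB n _ lT.
have hr : has_taylor (remainder f a n.+1) (B n (T n)).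
  apply: (eq_has_taylor _ (has_taylor_bmul disc_max n hT lT)) => z hz.
  by rewrite remainderE.
by rewrite (h2normE hr lt) (sqnE lt) (dot_bmul disc_max n lT lT) -sqnE.
Qed.

Lemma r_ge0 n : 0 <= r n.
Proof. by have [_ lT] := taylor_iterate n; exact: sqn_ge0. Qed.

(** Pythagoras for the splitting of the [n]-th iterate into its projection on
the kernel and a multiple of the squared Moebius factor. *)
Lemma r_step n : r n = normc (x n) ^+ 2 + r n.+1.
Proof.
have [hT lT] := taylor_iterate n; have [hT' lT'] := taylor_iterate n.+1.
have hn := disc_max (ltn0Sn n).
have lm := l2_mmul2 disc_max n lT'.
have E : T n = fun k => mmul (a n.+1) (mmul (a n.+1) (T n.+1)) k + x n * s n k.
  apply: (has_taylor_unique hT).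
  apply: eq_has_taylor (has_taylorD (has_taylor_mmul2 disc_max n hT' lT')
    (@has_taylorZ _ (x n) _ _ (has_taylor_szego hn))) => z hz.
  by rewrite [RHS]deflation_step // addrC.
rewrite /r E sqn_comb //; last exact: l2_s.
rewrite mmul2_orth //; last exact: disc_max.
rewrite mulr0 /= mulr0 addr0 addrC; congr (_ + _).
  by rewrite [sqn (s n)]sqnE ?dot_szego_self ?mulr1 //; exact: l2_s.
rewrite sqnE // (dot_mmul (l2_mmul lT' hn) (l2_mmul lT' hn) hn) (dot_mmul lT' lT' hn).
by rewrite -sqnE.
Qed.

(** The remainder is orthogonal to the terms already subtracted from [f]. *)
Lemma r_dot n : dot (B n (T n)) cf = (r n)%:C.
Proof.
have [hT lT] := taylor_iterate n; have lt := @lB n _ lT.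
have lsum : l2 (fun k => \sum_(j < n) x j * B j (s j) k).
  by apply: l2_sum => j; exact: l2_term.
rewrite (dotC lf lt) [X in dot X _](cf_expansion n) (dotDl lsum lt lt).
rewrite (@dot_suml _ _ _ (fun (j : 'I_n) k => x j * B j (s j) k)) //; last by move=> j;
  exact: l2_term.
rewrite big1 ?add0r => [|j _]; last first.
  have lj := @lB j _ (@l2_s j).
  rewrite dotZl // (dotC lt lj) (bmul_orth disc_max (ltn_ord j) lT).
  by rewrite rmorph0 mulr0.
by rewrite (dot_bmul disc_max n lT lT) dotcc // conjc_real.
Qed.

(** As [|P_n| <= 1] on the disc, pairing the remainder with a kernel yields no
more than pairing the [n]-th iterate with it, and [a n.+1] maximizes the latter. *)
Lemma dot_kernel_le n b : disc b -> normc (dot (B n (T n)) (szegoseq b)) <= normc (x n).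
Proof.
move=> hb; have [hT lT] := taylor_iterate n; have lt := @lB n _ lT.
rewrite dot_szego // (evE (has_taylor_bmul disc_max n hT lT) hb) mulrCA normcM.
have [_ hle] := hmax (ltn0Sn n).
have hx : normc (ip (ft n.+1) (szego b)) <= normc (x n) by rewrite -lecR; exact: (hle b hb).
apply: le_trans hx; rewrite (ip_szego hT lT hb) ler_piMl ?normc_ge0 //.
by apply: normc_blaschke2_le1 hb; exact: disc_max.
Qed.

(** [r n] is the pairing of the remainder with [f].  With a finite sum of atoms
in place of [f] the pairing is at most [M |x n|]; the error is controlled by
[Re_dot_le], letting first the number of atoms tend to infinity and then [t] to
[0]. *)
Lemma r_le_atomic (M : R) : 0 < M -> forall b c : nat -> C,
  (forall k, disc (b k)) -> (\sum_(0 <= k <oo) (normc (c k))%:E <= M%:E)%E ->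
  h2norm (fun z => f z - \sum_(k < n) c k * szego (b k) z) @[n --> \oo] --> 0 ->
  forall n, r n <= M * normc (x n).
Proof.
move=> M0 b c hb hc hlim n.
have [hT lT] := taylor_iterate n; have lt := @lB n _ lT.
pose q N k := \sum_(i < N) c i * szegoseq (b i) k.
have lterm i : l2 (fun k => c i * szegoseq (b i) k) by apply: l2Z; exact: l2_szego.
have lq N : l2 (q N) by apply: (l2_sum (F := fun (i : 'I_N) k => c i * szegoseq (b i) k)).
have ld N := l2B lf (lq N).
have hd N : has_taylor (fun z => f z - \sum_(k < N) c k * szego (b k) z)
    (fun k => cf k - q N k).
  apply: has_taylorB hf _; apply: has_taylor_sum => i.
  by apply: has_taylorZ; exact: has_taylor_szego.
have hsq : sqn (fun k => cf k - q N k) @[N --> \oo] --> 0.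
  have -> : (fun N => sqn (fun k => cf k - q N k)) =
      fun N => h2norm (fun z => f z - \sum_(k < N) c k * szego (b k) z) *
               h2norm (fun z => f z - \sum_(k < N) c k * szego (b k) z).
    by apply/funext => N; rewrite (h2normE (hd N) (ld N)) -expr2 sqr_sqrtr // sqn_ge0.
  have h2 := cvgM hlim hlim; rewrite mulr0 in h2; exact: h2.
have hpart N : complex.Re (dot (B n (T n)) (q N)) <= M * normc (x n).
  apply: le_trans (ler_norm _) (le_trans (normr_Re_le _) _).
  rewrite (dotC (lq N) lt) normc_conj /q.
  rewrite (@dot_suml _ _ _ (fun (i : 'I_N) k => c i * szegoseq (b i) k)) //.
  apply: (@le_trans _ _ (\sum_(i < N) normc (c i) * normc (x n))).
    elim: (index_enum _) => [|i t IH]; first by rewrite !big_nil [normc _]normc0.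
    rewrite !big_cons (le_trans (le_normcD _ _)) // lerD //.
    have lsb := l2_szego (hb i).
    rewrite dotZl // normcM ler_wpM2l ?normc_ge0 //.
    by rewrite (dotC lt lsb) normc_conj dot_kernel_le.
  rewrite -mulr_suml ler_wpM2r ?normc_ge0 // -lee_fin.
  apply: le_trans hc; rewrite -sumEFin -(big_mkord xpredT (fun k => (normc (c k))%:E)).
  by apply: nneseries_lim_ge => k _ _; rewrite lee_fin normc_ge0.
have hN (t : R) N : 0 < t ->
    r n <= M * normc (x n) + t * (r n / 2) + sqn (fun k => cf k - q N k) / (2 * t).
  move=> t0.
  have rE : r n = complex.Re (dot (B n (T n)) (q N)) +
                  complex.Re (dot (B n (T n)) (fun k => cf k - q N k)).
    by rewrite dotBr // ReB r_dot /= addrC subrK.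
  have rB : sqn (B n (T n)) = r n.
    by rewrite sqnE // (dot_bmul disc_max n lT lT) -sqnE.
  have h1 := hpart N; have h2 := @Re_dot_le _ _ _ t lt (ld N); rewrite rB in h2.
  rewrite [leLHS]rE; move: h1 h2.
  set u := complex.Re (dot _ (q N)); set v := complex.Re _; set w := sqn _ => h1 h2.
  have h3 : v <= t * (r n / 2) + w / (2 * t).
    rewrite -(@ler_pM2l _ (2 * t)) ?mulr_gt0 //.
    have -> : 2 * t * (t * (r n / 2) + w / (2 * t)) = t ^+ 2 * r n + w.
      by field; rewrite gt_eqF.
    exact: h2.
  by rewrite -addrA lerD.
have ht (t : R) : 0 < t -> r n <= M * normc (x n) + t * (r n / 2).
  move=> t0.
  have hl : M * normc (x n) + t * (r n / 2) + sqn (fun k => cf k - q N k) / (2 * t)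
      @[N --> \oo] --> M * normc (x n) + t * (r n / 2) + 0 / (2 * t).
    by apply: cvgD; [exact: cvg_cst|apply: cvgM; [exact: hsq|exact: cvg_cst]].
  rewrite mul0r addr0 in hl.
  by apply: (ler_cvg_to (cvg_cst (r n)) hl); apply: nearW => N; exact: hN.
by apply: le_epsM ht; rewrite divr_ge0 // r_ge0.
Qed.

(** From [r_n <= M |x_n|] and Pythagoras, [r_(n+1) <= r_n - r_n^2 / M^2] and
[r_0 <= M^2]; then induction. *)
Lemma greedy_rate (M : R) : 0 < M -> (forall n, r n <= M * normc (x n)) ->
  forall n, r n * n.+1%:R <= M ^+ 2.
Proof.
move=> M0 hM.
have hx n : r n ^+ 2 <= M ^+ 2 * normc (x n) ^+ 2.
  by rewrite -exprMn lerXn2r ?nnegrE ?r_ge0 ?mulr_ge0 ?normc_ge0 // ltW.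
have r1 n : r n <= M ^+ 2.
  have [->|r0] := eqVneq (r n) 0; first exact: sqr_ge0.
  have rp : 0 < r n by rewrite lt_neqAle eq_sym r0 r_ge0.
  rewrite -(ler_pM2r rp) -expr2 (le_trans (hx n)) // ler_wpM2l ?sqr_ge0 //.
  by rewrite [leRHS]r_step lerDl r_ge0.
elim=> [|n IH]; first by rewrite mulr1.
have M2 : 0 < M ^+ 2 by rewrite exprn_gt0.
rewrite -(ler_pM2l M2) -[n.+2%:R]natr1 -[M ^+ 2 * M ^+ 2]expr2.
have := hx n; have := r_step n; have := r1 n; have := r_ge0 n; have := r_ge0 n.+1.
move: IH M2; move: (r n) (r n.+1) (normc (x n) ^+ 2) (M ^+ 2) (n.+1%:R : R) (ler0n R n.+1).
move=> u v y m k k0 IH M2 v0 u0 um ustep hxn.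
have h1 : m * v <= u * (m - u) by rewrite ustep; nra.
have h2 : m * v * (k + 1) <= u * (m - u) * (k + 1) by rewrite ler_wpM2r //; lra.
have h3 : u * k * (m - u) <= m * (m - u) by rewrite ler_wpM2r // subr_ge0.
have h4 : 0 <= u ^+ 2 by exact: sqr_ge0.
rewrite mulrA; apply: (le_trans h2).
rewrite (_ : u * (m - u) * (k + 1) = u * k * (m - u) + u * (m - u)); last by ring.
rewrite (le_trans (lerD h3 (lexx _))) //.
by rewrite -subr_ge0 (_ : _ - _ = u ^+ 2) //; ring.
Qed.

End Greedy.

Theorem theorem2 (R : realType) (M : R) (hM : 0 < M)
    (f : R[i] -> R[i]) (hf : H2_atomic M f)
    (ft : nat -> R[i] -> R[i]) (a : nat -> R[i])
    (hft1 : forall z, disc z -> ft 1%N z = f z)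
    (ha : forall k, (1 <= k)%N -> maximizes (ft k) (a k))
    (hft : forall k, (1 <= k)%N -> deflation (ft k) (a k) (ft k.+1)) :
  forall n, (1 <= n)%N ->
    h2norm (remainder f a n) <= M / Num.sqrt n%:R.
Proof.
case: hf => hf2 [b [c [hb hc hlim]]] [//|n] _.
have [hf _] := hf2; have lf := l2_H2 hf2.
have hr := r_le_atomic hf lf hft1 ha hft hM hb hc hlim.
have := greedy_rate hf lf hft1 ha hft hM hr n.
rewrite (h2norm_remainder hf lf hft1 ha hft) => h.
have n0 : 0 < n.+1%:R :> R by rewrite ltr0n.
rewrite ler_pdivlMr ?sqrtr_gt0 // -sqrtrM ?(r_ge0 hf lf hft1 ha hft) //.
by rewrite -[leRHS](ger0_norm (ltW hM)) -sqrtr_sqr ler_wsqrtr.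
Qed.
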